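(* Let $L\in\mathbb{R}^d\setminus\{0\}$, let $f\in\mathcal{D}(\mathcal{A}_L)\cap\mathcal{D}(\mathcal{B}_L)$ be non-zero, and suppose that $$f(x_1,\dots,x_k,\dots,x_d)=-f(x_1,\dots,-x_k,\dots,x_d)$$ for all $k=1,\dots,d$ and $x\in\mathbb{R}^d$. Then $$\mathrm{UP}_L(f)\ge\frac94.$$
   Context: Notation: $d\in\mathbb{N}$; $\langle x,y\rangle$ and $\|x\|$ are the Euclidean inner product and norm on $\mathbb{R}^d$; functions are complex-valued; $\|f\|_2$ and $\langle f,g\rangle=\int_{\mathbb{R}^d}f\overline g$ are the norm and inner product of $L_2(\mathbb{R}^d)$. For $L\in\mathbb{R}^d\setminus\{0\}$, $\frac{\partial f}{\partial L}=\sum_{j=1}^dL_j\frac{\partial f}{\partial x_j}$ and $$\mathcal{A}_Lf(x)=2\pi\langle L,x\rangle f(x),\qquad \mathcal{B}_Lf(x)=\frac{\mathrm{i}}{2\pi}\frac{\partial f}{\partial L}(x),$$ with $\mathcal{D}(\mathcal{A}_L)=\{f\in L_2(\mathbb{R}^d):\int\|x\|^2|f(x)|^2\mathrm{d}x<\infty\}$ and $\mathcal{D}(\mathcal{B}_L)=H^1(\mathbb{R}^d)$ (functions in $L_2(\mathbb{R}^d)$ whose first-order derivatives are in $L_2(\mathbb{R}^d)$). $\Delta(\mathcal{A},f)=\|\mathcal{A}f\|_2^2-\frac{|\langle\mathcal{A}f,f\rangle|^2}{\|f\|_2^2}$, and for non-zero $f$ $$\mathrm{UP}_L(f)=\frac{\Delta(\mathcal{A}_L,f)\Delta(\mathcal{B}_L,f)}{\|L\|^4\|f\|_2^4}.$$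 *)

(* Defs.v *)
From HB Require Import structures.
From mathcomp Require Import all_boot all_order all_algebra.
From mathcomp Require Import all_classical all_reals all_analysis.
From mathcomp.real_closed Require Export complex.

Set Implicit Arguments.
Unset Strict Implicit.
Unset Printing Implicit Defensive.

Import Order.TTheory GRing.Theory Num.Theory.
Import numFieldNormedType.Exports.

Local Open Scope classical_set_scope.
Local Open Scope ring_scope.

Fact rV_display : measure_display. Proof. exact: default_measure_display. Qed.

Section measurable_rV.
Context {R : realType} (n : nat).

Definition rV_coord (i : 'I_n) (x : 'rV[R]_n) : measurableTypeR R := x ord0 i.

Let rV_set0 : g_sigma_preimage rV_coord set0.
Proof. exact: sigma_algebra0. Qed.

Let rV_setC A : g_sigma_preimage rV_coord A -> g_sigma_preimage rV_coord (~` A).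
Proof. exact: sigma_algebraC. Qed.

Let rV_bigcup (F : (set 'rV[R]_n)^nat) :
  (forall i, g_sigma_preimage rV_coord (F i)) ->
  g_sigma_preimage rV_coord (\bigcup_i F i).
Proof. exact: sigma_algebra_bigcup. Qed.

(** The product sigma-algebra, i.e. the Borel sets of [R^n]. *)
HB.instance Definition _ := @isMeasurable.Build rV_display 'rV[R]_n
  (g_sigma_preimage rV_coord) rV_set0 rV_setC rV_bigcup.

End measurable_rV.

Section lebesgue_rV.
Context {R : realType}.

Lemma measurable_rV_coord n (i : 'I_n) :
  measurable_fun [set: 'rV[R]_n] (@rV_coord R n i).
Proof.
move=> _ Y mY; rewrite setTI; apply: sub_sigma_algebra => /=.
rewrite -bigcup_seq/=; exists i => /=; first by rewrite mem_index_enum.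
by exists Y => //; rewrite setTI.
Qed.

Definition rV_cons n (p : measurableTypeR R * 'rV[R]_n) : 'rV[R]_n.+1 :=
  \row_(i < n.+1) if unlift ord0 i is Some j then p.2 ord0 j else p.1.

Lemma measurable_fun_rV d (T : measurableType d) n (f : T -> 'rV[R]_n) :
  (forall i, measurable_fun setT (rV_coord i \o f)) -> measurable_fun setT f.
Proof.
move=> mf _ A mA; rewrite setTI; move: A mA.
suff : (@measurable _ 'rV[R]_n) `<=` image_set_system setT f measurable.
  by move=> h A /h; rewrite /image_set_system /= setTI.
apply: smallest_sub; first exact/sigma_algebra_image/sigma_algebra_measurable.
case: n f mf => [|n] f mf; first by rewrite big_ord0.
rewrite -bigcup_mkord_ord => B [k kn] [C mC <-].
by rewrite /image_set_system /= !setTI -[X in measurable X]setTI; exact: mf.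
Qed.

Lemma measurable_rV_cons n : measurable_fun setT (@rV_cons n).
Proof.
apply: measurable_fun_rV => i; have [j ->|->] := unliftP ord0 i.
- rewrite (_ : _ \o _ = rV_coord j \o snd); last first.
    by apply/funext => p /=; rewrite /rV_coord mxE liftK.
  exact: measurableT_comp (measurable_rV_coord j) measurable_snd.
- rewrite (_ : _ \o _ = fst); first exact: measurable_fst.
  by apply/funext => p /=; rewrite /rV_coord mxE unlift_none.
Qed.

Section step.
Local Open Scope ereal_scope.
Variables (n : nat) (m : {sigma_finite_measure set 'rV[R]_n -> \bar R}).

Definition lebesgue_rV_step : set 'rV[R]_n.+1 -> \bar R :=
  pushforward (@lebesgue_measure R \x m) (@rV_cons n).

Let preimage_rV_cons (A : set 'rV[R]_n.+1) :
  measurable A -> measurable (@rV_cons n @^-1` A).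
Proof. by rewrite -[X in _ -> measurable X]setTI; exact: measurable_rV_cons. Qed.

Let step0 : lebesgue_rV_step set0 = 0.
Proof. by rewrite /lebesgue_rV_step /pushforward preimage_set0 measure0. Qed.

Let step_ge0 A : 0 <= lebesgue_rV_step A.
Proof. by rewrite /lebesgue_rV_step /pushforward measure_ge0. Qed.

Let step_sigma_additive : semi_sigma_additive lebesgue_rV_step.
Proof.
move=> F mF tF mUF; rewrite /lebesgue_rV_step /pushforward preimage_bigcup.
apply: measure_semi_sigma_additive.
- by move=> k; exact: preimage_rV_cons.
- apply/trivIsetP => /= i j _ _ ij; rewrite -preimage_setI.
  by move/trivIsetP : tF => /(_ _ _ _ _ ij) ->//; rewrite preimage_set0.
- by rewrite -preimage_bigcup; exact: preimage_rV_cons.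
Qed.

HB.instance Definition _ := isMeasure.Build _ _ _ lebesgue_rV_step
  step0 step_ge0 step_sigma_additive.

Let step_sigma_finite : sigma_finite setT lebesgue_rV_step.
Proof.
have [F FT Foo] := sigma_finiteT (@lebesgue_measure R).
have [G GT Goo] := sigma_finiteT m.
pose H (p : nat * nat) : set 'rV[R]_n.+1 :=
  [set x | F p.1 (rV_coord ord0 x) /\
           G p.2 (\row_j rV_coord (lift ord0 j) x)].
have HE p : @rV_cons n @^-1` H p = F p.1 `*` G p.2.
  apply/funext => -[a v]; rewrite /preimage /H /=.
  rewrite /rV_coord !mxE unlift_none /=.
  suff -> : (\row_j (rV_cons (a, v)) ord0 (lift ord0 j)) = v by [].
  by apply/rowP => j; rewrite !mxE liftK.
have mtail : measurable_fun setT (fun x : 'rV[R]_n.+1 =>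
    (\row_j rV_coord (lift ord0 j) x) : 'rV[R]_n).
  apply: measurable_fun_rV => j.
  rewrite (_ : _ \o _ = rV_coord (lift ord0 j)).
    exact: measurable_rV_coord.
  by apply/funext => x /=; rewrite /rV_coord mxE.
have mH p : measurable (H p).
  have [mF _] := Foo p.1; have [mG _] := Goo p.2.
  apply: measurableI.
    by rewrite -[X in measurable X]setTI; exact: measurable_rV_coord.
  by rewrite -[X in measurable X]setTI; exact: mtail.
exists (fun k => if unpickle k is Some p then H p else set0).
  apply/seteqP; split => // x _.
  have : [set: R] (rV_coord ord0 x) by [].
  rewrite FT => -[i _ Fi].
  have : [set: 'rV[R]_n] (\row_j rV_coord (lift ord0 j) x) by [].
  rewrite GT => -[j _ Gj].
  by exists (pickle (i, j)) => //=; rewrite pickleK.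
move=> k; case: unpickle => [p|]; last by rewrite measure0; split.
have [mF Flt] := Foo p.1; have [mG Glt] := Goo p.2.
split; first exact: mH.
rewrite /lebesgue_rV_step /pushforward HE product_measure1E//.
by rewrite lte_mul_pinfty// ge0_fin_numE.
Qed.

HB.instance Definition _ := Measure_isSigmaFinite.Build _ _ _ lebesgue_rV_step
  step_sigma_finite.

End step.

Fixpoint lebesgue_rV n : {sigma_finite_measure set 'rV[R]_n -> \bar R} :=
  if n is k.+1 then lebesgue_rV_step (lebesgue_rV k) else \d_(0 : 'rV[R]_0).

Lemma lebesgue_rV_box n (A : 'I_n -> set (measurableTypeR R)) :
  (forall i, measurable (A i)) ->
  lebesgue_rV n [set x | forall i, A i (rV_coord i x)] =
  (\prod_(i < n) lebesgue_measure (A i))%E.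
Proof.
elim: n A => [|n IH] A mA.
  by rewrite big_ord0 /= diracE mem_set// => -[].
rewrite big_ord_recl -IH; last by move=> i; exact: mA.
rewrite /= /lebesgue_rV_step /pushforward.
rewrite (_ : _ @^-1` _ =
    A ord0 `*` [set x | forall i, A (lift ord0 i) (rV_coord i x)]); last first.
  apply/seteqP; split => -[a v] /=.
    move=> h; split; first by have := h ord0; rewrite /rV_coord mxE unlift_none.
    by move=> i; have := h (lift ord0 i); rewrite /rV_coord mxE liftK.
  by move=> [A0 h] i; have [j ->|->] := unliftP ord0 i;
    rewrite /rV_coord mxE ?liftK ?unlift_none//; exact: h.
rewrite product_measure1E//.
rewrite (_ : mkset _ = \bigcap_(i in setT)
    (rV_coord i @^-1` A (lift ord0 i))); last first.
  by apply/seteqP; split => x /= h i; [move=> _|]; exact: h.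
apply: fin_bigcap_measurable => // i _.
by rewrite -[X in measurable X]setTI; exact: measurable_rV_coord.
Qed.

End lebesgue_rV.

Import ComplexField.Normc.

Section uncertainty.
Context {R : realType} {d : nat}.
Local Notation V := 'rV[R]_d.
Local Notation C := R[i].
Local Notation mu := (@lebesgue_rV R d).
Implicit Types (x y L : V) (j : 'I_d) (f g : V -> C) (phi : V -> R).

(* The norm the library puts on ['rV[R]_d] is the max norm. *)
Definition dotv x y : R := \sum_(j < d) x ord0 j * y ord0 j.
Definition enorm x : R := Num.sqrt (dotv x x).

Definition cmeasurable f :=
  measurable_fun setT (fun x => complex.Re (f x)) /\
  measurable_fun setT (fun x => complex.Im (f x)).

Definition cintegral f : C :=
  Complex (\int[mu]_x complex.Re (f x)) (\int[mu]_x complex.Im (f x)).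

(* An element of [L_2] is given by a Borel representative (every class has
   one), so equalities between elements of [L_2] are to be read a.e. *)
Definition inL2 f :=
  cmeasurable f /\ (\int[mu]_x (normc (f x) ^+ 2)%:E < +oo)%E.

Definition L2inner f g : C := cintegral (fun x => f x * conjc (g x)).
Definition L2norm f : R := Num.sqrt (\int[mu]_x normc (f x) ^+ 2).

Definition unitv j : V := delta_mx ord0 j.

Fixpoint Ck (k : nat) phi : Prop :=
  continuous phi /\
  if k is m.+1 then
    forall j, (forall x, derivable phi x (unitv j)) /\ Ck m ('D_(unitv j) phi)
  else True.

Definition test_function phi :=
  (forall k, Ck k phi) /\ compact (closure [set x | phi x != 0]).

(* Real test functions suffice: complex ones add nothing, by linearity. *)
Definition is_weak_partial j f g :=
  forall phi, test_function phi ->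
    cintegral (fun x => f x * real_complex R ('D_(unitv j) phi x)) =
    - cintegral (fun x => g x * real_complex R (phi x)).

Definition L2_weak_partial j f : set (V -> C) :=
  [set g | inL2 g /\ is_weak_partial j f g].

(* Weak derivatives are unique up to null sets, so for [f] in [H^1] the
   choice made here does not affect any integral; the value is [0] when there
   is no weak derivative in [L_2]. *)
Definition weak_partial j f : V -> C := xget (fun=> 0) (L2_weak_partial j f).

Definition H1 f := inL2 f /\ forall j, L2_weak_partial j f !=set0.

Definition ddir L f : V -> C :=
  fun x => \sum_(j < d) real_complex R (L ord0 j) * weak_partial j f x.

Definition opA L f : V -> C :=
  fun x => real_complex R (2 * pi * dotv L x) * f x.
Definition domA f :=
  inL2 f /\ (\int[mu]_x (enorm x ^+ 2 * normc (f x) ^+ 2)%:E < +oo)%E.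

Definition opB L f : V -> C := fun x => Complex 0 (2 * pi)^-1 * ddir L f x.
Definition domB f := H1 f.

Definition Delta (T : (V -> C) -> (V -> C)) f : R :=
  L2norm (T f) ^+ 2 - normc (L2inner (T f) f) ^+ 2 / L2norm f ^+ 2.

Definition UP L f : R :=
  Delta (opA L) f * Delta (opB L) f / (enorm L ^+ 4 * L2norm f ^+ 4).

Definition flip_coord j x : V := \row_i if i == j then - x ord0 i else x ord0 i.

End uncertainty.

(* Main.v *)
Require Import Defs.
From HB Require Import structures.
From mathcomp Require Import all_boot all_order all_algebra.
From mathcomp Require Import all_classical all_reals all_analysis.
From mathcomp Require Import measurable_realfun ring lra.

Set Implicit Arguments.
Unset Strict Implicit.
Unset Printing Implicit Defensive.

Import Order.TTheory GRing.Theory Num.Theory.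
Import numFieldNormedType.Exports.

Local Open Scope classical_set_scope.
Local Open Scope ring_scope.

(** The uncertainty product of an odd function.

    Because f is odd in every coordinate, the means of A_L and B_L vanish and the
    variances split into sums over the coordinates without mixed terms: up to the
    factors (2 pi)^2 and (2 pi)^-2, which cancel, they are A = sum L_i^2 |x_i f|^2
    and B = sum L_i^2 |d_i f|^2 ([Delta_opA], [Delta_opB]).  It is then enough to
    prove, for each coordinate and each t >= 0, the inequality
    3 t |f|^2 <= |d_i f|^2 + t^2 |x_i f|^2 ([odd_oscillator_ge]): summed with weights
    L_i^2 it says that 3 t |L|^2 |f|^2 <= B + t^2 A for all t >= 0, and the
    discriminant of this quadratic is the claim.

    The inequality is the lower bound 3 for the harmonic oscillator on odd functions.
    If u vanishes at 0 and w(s) = 1/(s + a) - t s, then expanding the integral of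
    (u' - w u)^2 over s > 0 and integrating by parts leaves the integral of
    u'^2 + (w' + w^2) u^2, where w' + w^2 = t^2 s^2 - t - 2 t s/(s + a); the limit
    a -> 0 gives the constant 3.

    The function f has only weak derivatives, so two things need care.
    First, the vanishing of f on the hyperplane x_j = 0 is expressed by
    [ray_identity]: on the half-space x_j > 0, f is almost everywhere the integral of
    its derivative along the segment that goes from the hyperplane to the point.  This
    follows by testing the weak derivative on functions that are even in x_j and
    tensor products of one-variable bumps; such products are dense enough because
    they approximate indicators of boxes ([box_integral_eq0]), and boxes generate the
    Borel sets ([box_ae0]).  The same fact gives the parity of the weak derivatives
    ([weak_partial_parity]).
    Secondly, the integration by parts is done with difference quotients.  The
    ray identity bounds pairings with the difference f(x + h e_j) - f(x)
    ([difference_dual]), translation invariance plays the role of the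
    product rule, and all errors are O(h) with explicit constants. *)

(** * Smooth functions of one variable *)

Section smooth1.
Context {R : realType}.
Implicit Types (f g : R -> R) (n : nat).

Fixpoint smooth_upto n f : Prop :=
  if n is m.+1 then (forall x, derivable f x 1) /\ smooth_upto m (derive1 f)
  else continuous f.

Definition smooth f := forall n, smooth_upto n f.

Lemma derivable_continuous f : (forall x, derivable f x 1) -> continuous f.
Proof. by move=> df x; apply: differentiable_continuous; apply/derivable1_diffP. Qed.

Lemma smooth_uptoW n f : smooth_upto n.+1 f -> smooth_upto n f.
Proof.
elim: n f => [|n IH] f [df sf]; first exact: derivable_continuous.
by split => //; exact: IH.
Qed.

Lemma smooth_upto_is_derive n f g :
  (forall x : R, is_derive x 1 f (g x)) -> smooth_upto n g -> smooth_upto n.+1 f.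
Proof.
move=> fg sg; split => [x|]; first by have [] := fg x.
suff -> : (derive1 f) = g by [].
by apply/funext => x; rewrite derive1E; have [] := fg x.
Qed.

Lemma smooth_is_derive f (x : R) : smooth f -> is_derive x 1 f ((derive1 f) x).
Proof. by move=> /(_ 1)[df _]; rewrite derive1E; exact: DeriveDef. Qed.

Lemma smooth_derive f : smooth f -> smooth (derive1 f).
Proof. by move=> sf n; have [] := sf n.+1. Qed.

Lemma smooth_continuous f : smooth f -> continuous f.
Proof. by move=> /(_ 0). Qed.

Lemma smooth_antiderivative f g :
  (forall x : R, is_derive x 1 f (g x)) -> smooth g -> smooth f.
Proof.
move=> fg sg [|n]; last exact: smooth_upto_is_derive fg (sg n).
by apply: derivable_continuous => x; have [] := fg x.
Qed.

Lemma smooth_cst (c : R) : smooth (cst c).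
Proof.
have s0 n : smooth_upto n (cst 0 : R -> R).
  elim: n => [x|n IH]; first exact: cvg_cst.
  by apply: smooth_upto_is_derive IH => x; exact: is_derive_cst.
apply: smooth_antiderivative (s0) => x; exact: is_derive_cst.
Qed.

Lemma smooth_upto_add n f g :
  smooth_upto n f -> smooth_upto n g -> smooth_upto n (f \+ g).
Proof.
elim: n f g => [|n IH] f g.
  by move=> cf cg x; apply: cvgD; [exact: cf|exact: cg].
move=> [df sf] [dg sg]; apply: (@smooth_upto_is_derive _ _ ((derive1 f) \+ (derive1 g))).
  by move=> x; rewrite /= !derive1E; apply: is_deriveD; apply: DeriveDef.
exact: IH.
Qed.

Lemma smooth_upto_mul n f g :
  smooth_upto n f -> smooth_upto n g -> smooth_upto n (f \* g).
Proof.
elim: n f g => [|n IH] f g.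
  by move=> cf cg x; apply: cvgM; [exact: cf|exact: cg].
move=> sf sg; have [df sf'] := sf; have [dg sg'] := sg.
apply: (@smooth_upto_is_derive _ _ ((f \* (derive1 g)) \+ (g \* (derive1 f)))).
  by move=> x; rewrite /= !derive1E; apply: is_deriveM; apply: DeriveDef.
by apply: smooth_upto_add; apply: IH => //; exact: smooth_uptoW.
Qed.

Lemma smooth_add f g : smooth f -> smooth g -> smooth (f \+ g).
Proof. by move=> sf sg n; exact: smooth_upto_add. Qed.

Lemma smooth_mul f g : smooth f -> smooth g -> smooth (f \* g).
Proof. by move=> sf sg n; exact: smooth_upto_mul. Qed.

Lemma is_derive_affine (c b x : R) : is_derive x 1 (fun x => c * x + b) c.
Proof. by apply: is_derive_eq; rewrite /= addr0 /GRing.scale /= mulr1. Qed.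

Lemma smooth_comp_affine f (c b : R) :
  smooth f -> smooth (fun x => f (c * x + b)).
Proof.
move=> sf n; elim: n f sf => [|n IH] f sf.
  move=> x; apply: (@continuous_comp _ _ _ (fun x => c * x + b) f).
    by apply: differentiable_continuous; apply/derivable1_diffP;
      have [] := is_derive_affine c b x.
  exact: smooth_continuous.
apply: (@smooth_upto_is_derive _ _ (cst c \* (fun x => (derive1 f) (c * x + b)))).
  move=> x; have := is_derive_affine c b x.
  have /= := @smooth_is_derive f (c * x + b) sf.
  by move=> h1 h2; rewrite /= mulrC; exact: is_derive1_comp.
by apply: smooth_upto_mul; [exact: smooth_cst|apply: IH; exact: smooth_derive].
Qed.

(** [flat 1] is the function exp(-1/x) extended by 0.  A polynomial factor in
    1/x makes the family closed under differentiation, so that smoothness of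
    all members follows by one induction. *)
Definition flat (p : {poly R}) (x : R) : R :=
  if 0 < x then p.[x^-1] * expR (- x^-1) else 0.

(** This is what makes [flat p] vanish to all orders at 0: with u = 1/x, any
    power of 1/x is absorbed by exp(-1/x). *)
Lemma poly_le_expR (p : {poly R}) :
  exists C, 0 <= C /\ forall u, 0 < u -> `|p.[u]| <= C * expR u.
Proof.
have mono k (u : R) : 0 < u -> u ^+ k <= k`!%:R * expR u.
  move=> u0; case: k => [|k].
    by rewrite expr0 mul1r -[leLHS]addr0 (le_trans _ (expR_ge1Dx _))// lerD2l ltW.
  have := expR_ge1Dxn k (ltW u0); rewrite -ler_pdivrMl ?ltr0n ?fact_gt0//.
  by rewrite mulrC; apply: le_trans; rewrite lerDr.
exists (\sum_(i < size p) `|p`_i| * i`!%:R); split.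
  by apply: sumr_ge0 => i _; rewrite mulr_ge0.
move=> u u0; rewrite horner_coef mulr_suml.
apply: le_trans (ler_norm_sum _ _ _) _; apply: ler_sum => i _.
rewrite normrM (ger0_norm (exprn_ge0 _ (ltW u0))) -mulrA.
by rewrite ler_wpM2l// mono.
Qed.

(** Away from 0 this is the chain rule; at 0 the difference quotient is
    (1/h) p(1/h) exp(-1/h), which [poly_le_expR] applied to X^2 p bounds by a
    multiple of h. *)
Lemma is_derive_flat (p : {poly R}) (x : R) :
  is_derive x 1 (flat p) (flat ('X^2 * (p - p^`())) x).
Proof.
have [x0|x0|x0] := ltgtP x 0.
- rewrite /flat ltNge (ltW x0)/=.
  apply: (near_eq_is_derive (f := cst (0 : R))) (is_derive_cst _ _ _).
  near=> y; rewrite /flat ltNge (_ : y <= 0)// ltW//.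
  by near: y; exact: lt_nbhsl.
- rewrite {2}/flat x0.
  have xn0 : x != 0 by rewrite gt_eqF.
  apply: (@near_eq_is_derive R R R (fun y => p.[y^-1] * expR (- y^-1))).
    near=> y; rewrite /flat (_ : 0 < y)//.
    by near: y; exact: lt_nbhsr.
  have dinv : is_derive x 1 (fun y : R => y^-1) (- x^-2).
    have := is_deriveV xn0 (is_derive_id x (1 : R)).
    by rewrite /GRing.scale /= mulr1.
  have dp : is_derive x 1 (fun y : R => p.[y^-1]) (p^`().[x^-1] * - x^-2).
    by have := @is_derive1_comp R (fun y => p.[y]) (fun y => y^-1) x _ _
       (is_derive_poly p (x^-1)) dinv.
  have de : is_derive x 1 (fun y : R => expR (- y^-1)) (expR (- x^-1) * x^-2).
    have := @is_derive1_comp R expR (fun y => - y^-1) x _ _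
       (is_derive_expR (- x^-1)) (is_deriveN dinv).
    by rewrite opprK.
  apply: is_derive_eq (is_deriveM dp de) _.
  rewrite /GRing.scale /= !hornerE /= exprVn; ring.
- subst x; have -> : flat ('X^2 * (p - p^`())) 0 = 0 by rewrite /flat ltxx.
  have [C [C0 HC]] := poly_le_expR ('X^2 * p).
  have lim0 : (fun h : R => h^-1 *: (flat p (h *: 1 + 0) - flat p 0)) @ 0^' --> (0 : R).
    have bnd (h : R) : `|h^-1 *: (flat p (h *: 1 + 0) - flat p 0)| <= C * `|h|.
      rewrite {2}/flat ltxx subr0 addr0 /GRing.scale /= mulr1 /flat.
      case: ifPn => [h0|_]; last by rewrite mulr0 normr0 mulr_ge0.
      have hn0 : h != 0 by rewrite gt_eqF.
      have := HC h^-1; rewrite invr_gt0 => /(_ h0).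
      rewrite !hornerE normrM [`|h^-1 ^+ 2|]ger0_norm ?sqr_ge0// => H.
      rewrite !normrM (ger0_norm (expR_ge0 _)) [`|h^-1|]gtr0_norm ?invr_gt0// [`|h|]gtr0_norm//.
      rewrite ?mulrA expRN ler_pdivrMr ?expR_gt0//.
      have : h * (h^-1 ^+ 2 * `|p.[h^-1]|) <= h * (C * expR h^-1).
        by rewrite ler_wpM2l// ltW.
      rewrite [leLHS](_ : _ = h^-1 * `|p.[h^-1]|); last by field.
      by move/le_trans; apply; rewrite mulrCA mulrA.
    have Cp : 0 < C + 1 by rewrite ltr_wpDl.
    apply/cvgr0Pnorm_le => /= e e0; near=> h; apply: le_trans (bnd h) _.
    apply: (@le_trans _ _ ((C + 1) * `|h|)).
      by rewrite ler_wpM2r// lerDl.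
    rewrite mulrC -ler_pdivlMr//; near: h.
    by apply: dnbhs0_le; rewrite divr_gt0.
  by apply: DeriveDef; [apply/cvg_ex; exists 0|exact/cvg_lim].
Unshelve. all: by end_near. Qed.

Lemma smooth_flat p : smooth (flat p).
Proof.
move=> n; elim: n p => [|n IH] p.
  by apply: derivable_continuous => x; have [] := is_derive_flat p x.
by apply: smooth_upto_is_derive (IH _) => x; exact: is_derive_flat.
Qed.

Lemma flat1_le0 (x : R) : x <= 0 -> flat 1 x = 0.
Proof. by move=> x0; rewrite /flat ltNge x0. Qed.

Lemma flat1_ge0 (x : R) : 0 <= flat 1 x.
Proof. by rewrite /flat; case: ifP => // _; rewrite hornerE mul1r expR_ge0. Qed.

Lemma flat1_le1 (x : R) : flat 1 x <= 1.
Proof.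
rewrite /flat; case: ifP => // x0; rewrite hornerE mul1r expR_le1.
by rewrite oppr_le0 invr_ge0 ltW.
Qed.

(** As n grows, exp(-1/(n x)) tends to 1 for x > 0 and stays 0 for x <= 0, so
    the bumps tend to the indicator of ]a, b[ while staying between 0 and 1.
    The arguments are in the form c * s + b of [smooth_comp_affine]. *)
Definition bump n (a b s : R) : R :=
  flat 1 (n.+1%:R * s + - (n.+1%:R * a)) * flat 1 (- n.+1%:R * s + n.+1%:R * b).

Lemma smooth_bump n a b : smooth (bump n a b).
Proof. by apply: smooth_mul; apply: smooth_comp_affine; exact: smooth_flat. Qed.

Lemma bump_out n a b s : s \notin `]a, b[ -> bump n a b s = 0.
Proof.
rewrite in_itv/= negb_and -!leNgt /bump => /orP[sa|bs].
  by rewrite flat1_le0 ?mul0r// -mulrBr pmulr_rle0 ?ltr0n// subr_le0.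
by rewrite mulrC flat1_le0 ?mul0r// mulNr addrC -mulrBr pmulr_rle0 ?ltr0n// subr_le0.
Qed.

Lemma bump_ge0 n a b s : 0 <= bump n a b s.
Proof. by rewrite mulr_ge0 ?flat1_ge0. Qed.

Lemma bump_le1 n a b s : bump n a b s <= 1.
Proof. by rewrite mulr_ile1 ?flat1_ge0 ?flat1_le1. Qed.

Lemma cvg_flat1 (c : R) : 0 < c -> flat 1 (n.+1%:R * c) @[n --> \oo] --> (1 : R).
Proof.
move=> c0; rewrite [X in X @ _ --> _](_ : _ = fun n => expR (- (c^-1 * n.+1%:R^-1))).
  rewrite -[X in _ --> X]expR0; apply: continuous_cvg; first exact: continuous_expR.
  rewrite -[X in _ --> X]oppr0; apply: cvgN; rewrite -[X in _ --> X](mulr0 c^-1).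
  by apply: cvgM; [exact: cvg_cst|exact: cvg_harmonic].
apply/funext => n; rewrite /flat pmulr_rgt0 ?ltr0n// c0 hornerE mul1r invfM.
by rewrite mulrC.
Qed.

Lemma cvg_bump a b s : bump n a b s @[n --> \oo] --> (\1_(`]a, b[%classic) s : R).
Proof.
rewrite indicE; have [|] := boolP (s \in `]a, b[); last first.
  move=> sab; rewrite memNset; last exact/negP.
  under eq_fun do rewrite bump_out//.
  exact: cvg_cst.
move=> sab; rewrite mem_set//=; move: sab; rewrite in_itv/= => /andP[sa sb].
rewrite /bump -[X in _ --> X](mulr1 (1 : R)); apply: cvgM.
  under eq_fun do rewrite -mulrBr.
  by apply: cvg_flat1; rewrite subr_gt0.
under eq_fun do rewrite mulNr addrC -mulrBr.
by apply: cvg_flat1; rewrite subr_gt0.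
Qed.

End smooth1.

(** * Tensor products as test functions *)

Section tensor.
Context {R : realType} {d : nat}.
Local Notation V := 'rV[R]_d.
Implicit Types (eta : 'I_d -> R -> R) (j : 'I_d) (x : V).

Definition tensor eta x : R := \prod_(i < d) eta i (x ord0 i).

Definition subst_factor j (g : R -> R) eta : 'I_d -> R -> R :=
  fun i => if i == j then g else eta i.

Lemma tensor_subst j g eta x :
  tensor (subst_factor j g eta) x =
  g (x ord0 j) * \prod_(i < d | i != j) eta i (x ord0 i).
Proof.
rewrite /tensor (bigD1 j)//= /subst_factor eqxx; congr (_ * _).
by apply: eq_bigr => i /negbTE ->.
Qed.

Lemma tensorD1 j eta x :
  tensor eta x = eta j (x ord0 j) * \prod_(i < d | i != j) eta i (x ord0 i).
Proof. by rewrite /tensor (bigD1 j). Qed.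

Lemma is_derive_tensor j eta x : smooth (eta j) ->
  is_derive x (unitv j) (tensor eta) (tensor (subst_factor j (derive1 (eta j)) eta) x).
Proof.
move=> sj; pose P := \prod_(i < d | i != j) eta i (x ord0 i).
have E : (fun h : R => h^-1 *: (tensor eta (h *: unitv j + x) - tensor eta x)) =
   (fun h : R => h^-1 *: ((P \*: eta j) (h *: 1 + x ord0 j) - (P \*: eta j) (x ord0 j))).
  apply/funext => h; congr (_ *: (_ - _)); last first.
    by rewrite (tensorD1 j) /= mulrC.
  rewrite (tensorD1 j) /= mulrC; congr (_ * _).
    apply: eq_bigr => i ij; congr (eta i _).
    by rewrite !mxE eqxx (negbTE ij) mulr0 add0r.
  by congr (eta j _); rewrite !mxE !eqxx.
have [dj vj] : is_derive (x ord0 j : R) 1 (P \*: eta j : R -> R) (P *: derive1 (eta j) (x ord0 j)).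
  by apply: is_deriveZ; exact: smooth_is_derive.
apply: DeriveDef; first by rewrite /derivable E.
by rewrite /derive E tensor_subst mulrC.
Qed.

Lemma continuous_tensor eta : (forall i, continuous (eta i)) -> continuous (tensor eta).
Proof.
move=> ceta; apply: (@continuous_big R 'I_d *%R 1 (fun=> true) (@mul_continuous R) V
  _ (fun i (x : V) => eta i (x ord0 i))) => i _ x.
apply: (@continuous_comp _ _ _ (fun x : V => x ord0 i) (eta i)); last exact: ceta.
exact: coord_continuous.
Qed.

Lemma smooth_subst_factor j eta :
  (forall i, smooth (eta i)) ->
  forall i, smooth (subst_factor j (derive1 (eta j)) eta i).
Proof.
move=> seta i; rewrite /subst_factor; case: eqP => // _; exact: smooth_derive.
Qed.

Lemma Ck_tensor k eta : (forall i, smooth (eta i)) -> Ck k (tensor eta).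
Proof.
elim: k eta => [|k IH] eta seta; split => //.
- by apply: continuous_tensor => i; exact: smooth_continuous.
- by apply: continuous_tensor => i; exact: smooth_continuous.
- move=> j; have dj x := is_derive_tensor x (seta j).
  split=> [x|]; first by have [] := dj x.
  rewrite (_ : 'D_(unitv j) _ = tensor (subst_factor j (derive1 (eta j)) eta)).
    by apply: IH; exact: smooth_subst_factor.
  by apply/funext => x; have [] := dj x.
Qed.

Lemma test_function_tensor eta :
  (forall i, smooth (eta i)) ->
  (forall i, exists M, forall s, M < `|s| -> eta i s = 0) ->
  test_function (tensor eta).
Proof.
move=> seta /choice[M HM]; split=> [k|]; first exact: Ck_tensor.
pose K : set V := [set x | forall i, `[- M i, M i]%classic (x ord0 i)].
have cK : compact K.
  by apply: (@rV_compact R d (fun i => `[- M i, M i]%classic)) => i; exact: segment_compact.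
apply: (subclosed_compact _ cK); first exact: closed_closure.
have clK : closed K by apply: compact_closed => //; exact: norm_hausdorff.
rewrite ((closure_id K).1 clK); apply: closureS => x /= tx i.
rewrite /= in_itv/= -ler_norml leNgt; apply/negP => Mx; move/eqP: tx; apply.
by rewrite (tensorD1 i) HM// mul0r.
Qed.

End tensor.

(** * Boxes generate the Borel sets *)

Section boxes.
Context {R : realType} {d : nat}.
Local Notation V := 'rV[R]_d.
Local Notation mu := (@lebesgue_rV R d).

Definition box (a b : 'I_d -> R) : set V :=
  [set x | forall i, `]a i, b i[%classic (x ord0 i)].

Definition boxes : set (set V) := [set A | exists a b, A = box a b].

Lemma setI_boxes : setI_closed boxes.
Proof.
move=> _ _ [a [b ->]] [a' [b' ->]].
exists (fun i => Num.max (a i) (a' i)), (fun i => Num.min (b i) (b' i)).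
apply/seteqP; split => x /=.
  move=> [xab xab'] i; have := xab i; have := xab' i.
  by rewrite /= !in_itv/= gt_max lt_min => /andP[-> ->] /andP[-> ->].
move=> h; split=> i; have := h i; rewrite /= !in_itv/= gt_max lt_min;
  by move=> /andP[/andP[? ?] /andP[? ?]]; apply/andP.
Qed.

Definition cube (k : nat) : set V := box (fun=> - k%:R) (fun=> k%:R).

Lemma cube_cover : \bigcup_k cube k = setT.
Proof.
apply/seteqP; split=> // x _.
pose M := \sum_i `|x ord0 i|.
have [k Mk] : exists k : nat, M < k%:R by exists (Num.truncn M).+1; exact: truncnS_gt.
exists k => // i /=; rewrite in_itv/= -ltr_norml; apply: le_lt_trans Mk.
by rewrite /M (bigD1 i)//= lerDl sumr_ge0.
Qed.

Lemma measurable_rV_boxes : @measurable _ V = <<s boxes >>.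
Proof.
apply/seteqP; split.
  apply: smallest_sub; first exact: smallest_sigma_algebra.
  have mc i : measurable_fun (setT : set (g_sigma_algebraType boxes))
      (fun x : V => x ord0 i : measurableTypeR R).
    apply: (measurability _ (measurable_realfun.RGenOpens.measurableE R)) => _ [_ [u [v ->] <-]].
    rewrite setTI (_ : _ @^-1` _ = \bigcup_k
       box (fun j => if j == i then u else - k%:R) (fun j => if j == i then v else k%:R)).
      apply: bigcupT_measurable => k; apply: sub_sigma_algebra.
      by do 2 eexists; reflexivity.
    apply/seteqP; split=> x /=.
      move=> xuv; have : [set: V] x by [].
      rewrite -cube_cover => -[k _ xk]; exists k => // j /=.
      by case: eqP => [->//|_]; exact: xk.
    by move=> [k _ /(_ i)]; rewrite eqxx.
  move=> B; rewrite -bigcup_seq => -[k _ [C mC <-]].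
  exact: mc.
apply: smallest_sub; first exact: sigma_algebra_measurable.
move=> _ [a [b ->]].
rewrite (_ : box a b = \bigcap_(i in setT) (@rV_coord R d i @^-1` `]a i, b i[)).
  apply: fin_bigcap_measurable => // i _.
  by rewrite -[X in measurable X]setTI; exact: measurable_rV_coord.
by apply/seteqP; split=> x /= h i; [move=> _|]; exact: h.
Qed.

Lemma measurable_box a b : measurable (box a b).
Proof.
by rewrite measurable_rV_boxes; apply: sub_sigma_algebra; exists a, b.
Qed.

Lemma lebesgue_box a b :
  mu (box a b) = (\prod_(i < d) lebesgue_measure (`]a i, b i[%classic : set R))%E.
Proof. by rewrite -lebesgue_rV_box. Qed.

Lemma lebesgue_box_lty a b : (mu (box a b) < +oo)%E.
Proof.
rewrite lebesgue_box.
have : (0 <= \prod_(i < d) lebesgue_measure (`]a i, b i[%classic : set R) < +oo)%E.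
  elim/big_ind: _ => [|x y /andP[x0 xoo] /andP[y0 yoo]|i _].
  - by rewrite lee01 ltry.
  - by rewrite mule_ge0//= lte_mul_pinfty// ge0_fin_numE.
  - rewrite measure_ge0/= lebesgue_measure_itv/=; case: ifP => _; last exact: ltry.
    by rewrite -EFinB ltry.
by move=> /andP[].
Qed.

(** Boxes form a pi-system that generates the Borel sets, and the cubes exhaust
    the space with finite measure. *)
Lemma rV_measure_unique (m : {measure set V -> \bar R}) :
  (forall a b, mu (box a b) = m (box a b)) ->
  forall A, measurable A -> mu A = m A.
Proof.
move=> h A mA; apply: (measure_unique boxes cube); last exact: mA.
- exact: measurable_rV_boxes.
- exact: setI_boxes.
- by move=> k; do 2 eexists; reflexivity.
- exact: cube_cover.
- by move=> _ [a [b ->]]; exact: h.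
- by move=> k; exact: lebesgue_box_lty.
Qed.

End boxes.

(** * Measure-preserving maps *)

Section preserving.
Context d (T : measurableType d) (R : realType) (m : {measure set T -> \bar R}).
Implicit Types (phi : T -> T).

Definition preserves phi := measurable_fun setT phi /\
  forall A, measurable A -> m (phi @^-1` A) = m A.

Variable phi : T -> T.
Hypothesis mphi : preserves phi.

Lemma preserves_ge0_integral (f : T -> \bar R) : measurable_fun setT f ->
  (forall x, (0 <= f x)%E) -> (\int[m]_x f (phi x) = \int[m]_x f x)%E.
Proof.
move=> mf f0.
have := @ge0_integral_pushforward _ _ _ _ _ _ mphi.1 m setT f measurableT mf (fun y _ => f0 y).
rewrite preimage_setT => <-; apply: eq_measure_integral => [|? A mA _]; [exact: mphi.1|exact: mphi.2].
Qed.

Lemma preserves_integrable (f : T -> \bar R) :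
  m.-integrable setT f -> m.-integrable setT (f \o phi).
Proof.
move=> /integrableP[mf foo]; apply/integrableP; split.
  by apply: measurableT_comp mf _; exact: mphi.1.
rewrite (preserves_ge0_integral (f := fun x => `|f x|%E))//.
exact: measurableT_comp.
Qed.

Lemma preserves_integral (f : T -> \bar R) : m.-integrable setT f ->
  (\int[m]_x f (phi x) = \int[m]_x f x)%E.
Proof.
move=> intf.
have := @integral_pushforward _ _ _ _ _ _ mphi.1 m setT f (measurable_int m intf).
rewrite preimage_setT => <-//; last exact: preserves_integrable.
apply: eq_measure_integral => [|? A mA _]; [exact: mphi.1|exact: mphi.2].
Qed.

Lemma preserves_Rintegral (f : T -> R) : m.-integrable setT (EFin \o f) ->
  \int[m]_x f (phi x) = \int[m]_x f x.
Proof. by move=> intf; congr fine; exact: preserves_integral intf. Qed.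

Lemma preserves_ae (P : T -> Prop) :
  {ae m, forall x, P x} -> {ae m, forall x, P (phi x)}.
Proof.
move=> [N [mN N0 PN]]; exists (phi @^-1` N); split.
- by rewrite -[X in measurable X]setTI; exact: mphi.1.
- by rewrite mphi.2.
- by move=> x; exact: PN.
Qed.

End preserving.

(** * Invariance of Lebesgue measure under translations and reflections *)

Section invariance.
Context {R : realType} {d : nat}.
Local Notation V := 'rV[R]_d.
Local Notation mu := (@lebesgue_rV R d).

Lemma measurable_coord (i : 'I_d) : measurable_fun setT (fun x : V => x ord0 i : R).
Proof. exact: measurable_rV_coord. Qed.

Lemma preserves_boxes (phi : V -> V) : measurable_fun setT phi ->
  (forall a b, mu (phi @^-1` (box a b)) = mu (box a b)) -> preserves mu phi.
Proof.
move=> mphi phibox; split => // A mA; apply/esym.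
by have := @rV_measure_unique R d (pushforward mu phi); apply => //;
  move=> *; exact/esym/phibox.
Qed.

Definition slide (j : 'I_d) (r : R) (x : V) : V := x + r *: unitv j.

Lemma slide_coord j r x i : (slide j r x) ord0 i = x ord0 i + (if i == j then r else 0).
Proof. by rewrite !mxE eqxx /=; case: eqP => _; rewrite ?mulr1 ?mulr0. Qed.

Lemma preserves_slide j r : preserves mu (slide j r).
Proof.
apply: preserves_boxes.
  apply: measurable_fun_rV => i; rewrite /comp /rV_coord.
  under eq_fun do rewrite slide_coord.
  by apply: measurable_funD => //; exact: measurable_coord.
move=> a b; pose c i := if i == j then r else 0.
rewrite (_ : _ @^-1` _ = box (fun i => a i - c i) (fun i => b i - c i)).
  rewrite !lebesgue_box; apply: eq_bigr => i _.
  rewrite !lebesgue_measure_itv/= !lte_fin ltrD2r; case: ifP => // _.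
  by rewrite -!EFinB; congr EFin; ring.
apply/seteqP; split=> x /= h i; have := h i; rewrite /= slide_coord -/(c i) !in_itv/=;
  by rewrite ltrBlDr ltrBrDr.
Qed.

Lemma flip_coordE j (x : V) i : flip_coord j x ord0 i = if i == j then - x ord0 i else x ord0 i.
Proof. by rewrite mxE. Qed.

Lemma flip_coordK j : involutive (flip_coord j : V -> V).
Proof.
by move=> x; apply/rowP => i; rewrite !flip_coordE; case: eqP => // _; rewrite opprK.
Qed.

Lemma preserves_flip j : preserves mu (flip_coord j).
Proof.
apply: preserves_boxes.
  apply: measurable_fun_rV => i; rewrite /comp /rV_coord.
  under eq_fun do rewrite flip_coordE.
  case: eqP => _; last exact: measurable_coord.
  by apply: measurableT_comp => //; exact: measurable_coord.
move=> a b.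
rewrite (_ : _ @^-1` _ = box (fun i => if i == j then - b i else a i)
                             (fun i => if i == j then - a i else b i)).
  rewrite !lebesgue_box; apply: eq_bigr => i _.
  case: eqP => // _; rewrite !lebesgue_measure_itv/= !lte_fin ltrN2; case: ifP => // _.
  by rewrite -!EFinB; congr EFin; ring.
apply/seteqP; split=> x /= h i; have := h i; rewrite /= flip_coordE; case: eqP => // _;
  by rewrite !in_itv/= ltrNl ltrNr andbC.
Qed.

Lemma preserves_translation (c : R) :
  preserves (@lebesgue_measure R) (fun t : measurableTypeR R => t + c : measurableTypeR R).
Proof.
have mt : measurable_fun setT (fun t : measurableTypeR R => t + c : measurableTypeR R).
  exact: measurable_funD.
split => // A mA; apply/esym.
have := @lebesgue_measure_unique R (pushforward lebesgue_measure (fun t : measurableTypeR R => t + c : measurableTypeR R)).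
apply => // _ [[a b]] _ <-.
transitivity (lebesgue_measure (`]a - c, b - c]%classic : set R)).
  rewrite !lebesgue_measure_itv/= !lte_fin ltrD2r; case: ifP => // _.
  by rewrite -!EFinB; congr EFin; ring.
congr (lebesgue_measure _).
by apply/seteqP; split=> x /=; rewrite !in_itv/= ltrBlDr lerBrDr.
Qed.

Lemma hyperplane0 j : mu [set x | x ord0 j = 0] = 0%E.
Proof.
pose A i : set (measurableTypeR R) := if i == j then [set 0] else setT.
have mA i : measurable (A i) by rewrite /A; case: eqP.
transitivity (mu [set x | forall i, A i (rV_coord i x)]).
  congr (mu _); apply/seteqP; split=> x /=.
    by move=> xj i; rewrite /A; case: eqP => [->|].
  by move=> /(_ j); rewrite /A eqxx.
rewrite lebesgue_rV_box// (bigD1 j)//= [A j]/A eqxx.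
by rewrite (lebesgue_measure_set1 0) mul0e.
Qed.

End invariance.

(** * Functions with vanishing integrals over boxes *)

Section vanishing.
Context {R : realType} {d : nat}.
Local Notation V := 'rV[R]_d.
Local Notation mu := (@lebesgue_rV R d).

(** Inside a fixed cube the sets over which H integrates to 0 form a Dynkin
    system, which contains the boxes and hence every Borel set. *)
Lemma box_ae0 (H : V -> R) : measurable_fun setT H ->
  (forall a b, mu.-integrable (box a b) (EFin \o H)) ->
  (forall a b, (\int[mu]_(x in box a b) (H x)%:E = 0)%E) ->
  {ae mu, forall x, H x = 0}.
Proof.
move=> mH iH H0.
have E k A : measurable A -> (\int[mu]_(x in cube k `&` A) (H x)%:E = 0)%E.
  move=> mA.
  have mk : measurable (@cube R d k) by exact: measurable_box.
  have ik : mu.-integrable (cube k) (EFin \o H) by exact: iH.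
  apply: (dynkin_induction (G := boxes) (P := fun A => (\int[mu]_(x in cube k `&` A) (H x)%:E = 0)%E)).
  - exact: measurable_rV_boxes.
  - exact: setI_boxes.
  - by rewrite setIT; exact: H0.
  - move=> B GB.
    have [a [b ->]] : boxes (cube k `&` B).
      by apply: setI_boxes => //; do 2 eexists; reflexivity.
    exact: H0.
  - move=> S mS S0.
    have := H0 (fun=> - k%:R) (fun=> k%:R); rewrite -/(cube k).
    rewrite -[X in (\int[mu]_(x in X) _)%E](setUIDK _ S).
    rewrite setDE integral_setU_EFin//; last 4 first.
    + exact: measurableI.
    + by apply: measurableI => //; exact: measurableC.
    + by apply: measurable_funS mH => //.
    + by apply/disj_setPS => x [[_ ?] [_ ?]].
    by move: S0 => /= ->; rewrite add0e.
  - move=> F mF tF F0; rewrite setI_bigcupr integral_bigcup//.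
    + by apply: eseries0 => i _ _; exact: F0.
    + exact: trivIset_setIl.
    + by move=> i; exact: measurableI.
    + apply: integrableS ik => //; first by apply: bigcupT_measurable => i; exact: measurableI.
      by move=> x [i _ []].
  - by rewrite -measurable_rV_boxes.
have aek k : {ae mu, forall x, cube k x -> H x = 0}.
  have := @integral_ae_eq _ V R mu (cube k) (measurable_box _ _) (cst 0%E) (EFin \o H).
  have mcst : measurable_fun (cube k) (cst 0%E : V -> \bar R) by [].
  move=> /(_ (iH _ _) mcst); case.
    move=> A Ak mA; rewrite integral0.
    by rewrite -(E k A mA) setIidr.
  move=> N [mN N0 sN]; exists N; split => // x /= h; apply: sN => /= h'.
  by apply: h => /h' /= [].
have /ae_foralln := aek; apply: filterS => x h.
have : [set: V] x by [].
by rewrite -cube_cover => -[k _ /h].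
Qed.

End vanishing.

(** * Integrable and square-integrable real functions *)

Section sqint.
Context d (T : measurableType d) (R : realType) (m : {measure set T -> \bar R}).
Implicit Types (f g : T -> R).

Notation intble f := (m.-integrable setT (EFin \o f)).

Lemma intble_measurable f : intble f -> measurable_fun setT f.
Proof. by move=> /integrableP[/measurable_EFinP]. Qed.

Lemma le_intble f g : measurable_fun setT f -> (forall x, `|f x| <= g x) ->
  intble g -> intble f.
Proof.
move=> mf fg; apply: le_integrable => //; first exact/measurable_EFinP.
by move=> x _; rewrite /= lee_fin (le_trans (fg x))// ler_norm.
Qed.

Lemma intbleD f g : intble f -> intble g -> intble (f \+ g).
Proof. by move=> hf hg; exact: (integrableD measurableT hf hg). Qed.

Lemma intbleZ (c : R) f : intble f -> intble (fun x => c * f x).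
Proof. by move=> hf; exact: (integrableZl measurableT c hf). Qed.

Lemma intbleB f g : intble f -> intble g -> intble (f \- g).
Proof. by move=> hf hg; exact: (integrableB measurableT hf hg). Qed.

Lemma intble_bounded f g (C : R) : measurable_fun setT g ->
  (forall x, `|g x| <= C) -> intble f -> intble (f \* g).
Proof.
move=> mg gC hf; have mf := intble_measurable hf.
apply: (@le_intble _ (fun x => C * `|f x|)).
- exact: measurable_funM.
- by move=> x; rewrite /= normrM mulrC ler_wpM2r.
- by apply: intbleZ; exact: integrable_norm hf.
Qed.

Lemma ae_Rintegral f g : measurable_fun setT f -> measurable_fun setT g ->
  {ae m, forall x, f x = g x} -> \int[m]_x f x = \int[m]_x g x.
Proof.
move=> mf mg fg; congr fine; apply: ae_eq_integral => //; try exact/measurable_EFinP.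
by apply: filterS fg => x -> .
Qed.

Lemma ae_intble f g : measurable_fun setT g ->
  {ae m, forall x, f x = g x} -> intble f -> intble g.
Proof.
move=> mg fg hf; apply/integrableP; split; first exact/measurable_EFinP.
have /integrableP[mf] := hf; apply: le_lt_trans; rewrite le_eqVlt; apply/orP; left; apply/eqP.
apply: ae_eq_integral => //; do ?exact: measurableT_comp.
  by apply: measurableT_comp => //; exact/measurable_EFinP.
by apply: filterS fg => x /= ->.
Qed.

Lemma le_ae_Rintegral f g : intble f -> intble g ->
  {ae m, forall x, f x <= g x} -> \int[m]_x f x <= \int[m]_x g x.
Proof.
move=> hf hg fg; have mf := intble_measurable hf; have mg := intble_measurable hg.
have mmax : measurable_fun setT (fun x => Num.max (f x) (g x)) by exact: measurable_maxr.
have fgE : {ae m, forall x, g x = Num.max (f x) (g x)}.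
  by apply: filterS fg => x fgx; rewrite max_r.
rewrite (ae_Rintegral mg mmax fgE); apply: le_Rintegral => //.
  exact: ae_intble fgE hg.
by move=> x _; rewrite le_max lexx.
Qed.

(** Real square-integrable functions, with measurability stated separately
    because the integrability of the square does not imply it. *)
Definition sqint f := measurable_fun setT f /\ intble (fun x => f x ^+ 2).

Lemma sqintM f g : sqint f -> sqint g -> intble (f \* g).
Proof.
move=> [mf hf] [mg hg]; apply: le_intble (intbleD hf hg).
  exact: measurable_funM.
move=> x /=; rewrite normrM.
have : 0 <= (`|f x| - `|g x|) ^+ 2 by rewrite sqr_ge0.
rewrite -(real_normK (num_real (f x))) -(real_normK (num_real (g x))).
have := normr_ge0 (f x); have := normr_ge0 (g x); nra.
Qed.

Lemma le_sqint f g : measurable_fun setT f -> (forall x, `|f x| <= `|g x|) ->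
  sqint g -> sqint f.
Proof.
move=> mf fg [mg hg]; split => //; apply: le_intble hg.
  exact: measurable_funX.
by move=> x; rewrite normrX -(real_normK (num_real (g x))) lerXn2r ?nnegrE.
Qed.

Lemma sqintZ (c : R) f : sqint f -> sqint (fun x => c * f x).
Proof.
move=> [mf hf]; split; first exact: measurable_funM.
by rewrite [X in intble X](_ : _ = fun x => c ^+ 2 * f x ^+ 2);
  [exact: intbleZ|apply/funext => x; rewrite exprMn].
Qed.

Lemma sqintD f g : sqint f -> sqint g -> sqint (f \+ g).
Proof.
move=> hf hg; split; first by apply: measurable_funD; [case: hf|case: hg].
rewrite [X in intble X](_ : _ = (fun x => f x ^+ 2) \+ (fun x => g x ^+ 2) \+
   (fun x => 2 * (f \* g) x)).
  apply: intbleD; first by apply: intbleD; [case: hf|case: hg].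
  by apply: intbleZ; exact: sqintM.
by apply/funext => x /=; ring.
Qed.

Lemma sqintB f g : sqint f -> sqint g -> sqint (f \- g).
Proof.
move=> hf hg; rewrite (_ : f \- g = f \+ (fun x => -1 * g x)).
  by apply: sqintD => //; exact: sqintZ.
by apply/funext => x /=; rewrite mulN1r.
Qed.

Lemma sqint_bounded f g (C : R) : measurable_fun setT g ->
  (forall x, `|g x| <= C) -> sqint f -> sqint (f \* g).
Proof.
move=> mg gC hf; apply: (@le_sqint _ (fun x => C * f x)).
- by apply: measurable_funM => //; case: hf.
- by move=> x /=; rewrite !normrM mulrC ler_wpM2r// (le_trans (gC x))// ler_norm.
- exact: sqintZ.
Qed.

Lemma sqint_preserves (phi : T -> T) f : preserves m phi -> sqint f -> sqint (f \o phi).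
Proof.
move=> hphi [mf hf]; split; first by apply: measurableT_comp mf _; case: hphi.
exact: (preserves_integrable hphi hf).
Qed.

End sqint.
Notation intble m f := (m.-integrable setT (EFin \o f)).

(** * From bumps to boxes *)

Section bump_limit.
Context {R : realType} {d : nat}.
Local Notation V := 'rV[R]_d.
Local Notation mu := (@lebesgue_rV R d).

Definition bumps n (a b : 'I_d -> R) : V -> R := tensor (fun i => bump n (a i) (b i)).

Lemma bumps_out n a b x : ~ box a b x -> bumps n a b x = 0.
Proof.
move=> /existsNP[i xi]; rewrite /bumps (tensorD1 i) bump_out ?mul0r//.
by apply/negP.
Qed.

Lemma bumps_ge0 n a b x : 0 <= bumps n a b x.
Proof. by apply: prodr_ge0 => i _; exact: bump_ge0. Qed.

Lemma bumps_le1 n a b x : bumps n a b x <= 1.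
Proof. by apply: prodr_ile1 => i _; rewrite bump_ge0 bump_le1. Qed.

Lemma measurable_tensor (eta : 'I_d -> R -> R) :
  (forall i, measurable_fun setT (eta i)) -> measurable_fun setT (tensor eta).
Proof.
move=> meta; rewrite /tensor; apply: measurable_prod => i _.
by apply: measurableT_comp => //; exact: measurable_coord.
Qed.

Lemma measurable_smooth (eta : R -> R) : smooth eta -> measurable_fun setT eta.
Proof. by move=> /smooth_continuous; exact: continuous_measurable_fun. Qed.

Lemma measurable_bumps n a b : measurable_fun setT (bumps n a b).
Proof. by apply: measurable_tensor => i; apply: measurable_smooth; exact: smooth_bump. Qed.

Lemma cvg_bumps a b x : box a b x -> bumps n a b x @[n --> \oo] --> (1 : R).
Proof.
move=> xab; rewrite (_ : 1 = \prod_(i < d) (1 : R)); last by rewrite big1.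
apply: (@cvg_big R 'I_d *%R 1 (fun=> true) (@mul_continuous R) nat).
move=> i _; have := @cvg_bump R (a i) (b i) (x ord0 i).
by rewrite indicE mem_set//; exact: xab.
Qed.

(** Dominated convergence: the bumps carried by the box tend to its
    indicator. *)
Lemma box_integral_eq0 (H : V -> R) a b : measurable_fun setT H ->
  mu.-integrable (box a b) (EFin \o H) ->
  (forall n, \int[mu]_x (H x * bumps n a b x) = 0) ->
  (\int[mu]_(x in box a b) (H x)%:E = 0)%E.
Proof.
move=> mH iH H0.
have mbox := @measurable_box R d a b.
have bint n : mu.-integrable (box a b) (fun x => (H x * bumps n a b x)%:E).
  apply: le_integrable iH => //.
    by apply/measurable_EFinP/measurable_funTS/measurable_funM => //; exact: measurable_bumps.
  move=> x _; rewrite /= lee_fin normrM (ger0_norm (bumps_ge0 _ _ _ _)).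
  by rewrite ler_piMr// bumps_le1.
have E n : (\int[mu]_(x in box a b) (H x * bumps n a b x)%:E = 0)%E.
  rewrite -[LHS]fineK; last exact: integrable_fin_num.
  rewrite -[RHS](_ : (\int[mu]_x (H x * bumps n a b x))%:E = 0%E); last by rewrite H0.
  congr EFin; rewrite /Rintegral; congr fine; rewrite [LHS]integral_mkcond; apply: eq_integral => x _.
  rewrite patchE; case: ifPn => // /negP xab.
  by rewrite bumps_out ?mulr0// => h; apply: xab; rewrite inE.
have := @dominated_convergence _ V R mu (box a b) mbox
  (fun n x => (H x * bumps n a b x)%:E) (EFin \o H) (fun x => `|(H x)%:E|%E).
case.
- by move=> n; exact: measurable_int (bint n).
- exact: measurable_int iH.
- apply: aeW => x xab; apply: cvg_EFin; first exact: nearW.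
  rewrite -[X in _ --> X]mulr1; apply: cvgM; first exact: cvg_cst.
  exact: cvg_bumps.
- exact: integrable_abse.
- apply: aeW => x n xab; rewrite /= lee_fin normrM (ger0_norm (bumps_ge0 _ _ _ _)).
  by rewrite ler_piMr// bumps_le1.
move=> _ _ /=.
rewrite (_ : (fun n => _) = fun=> 0%E); last by apply/funext => n; exact: E.
by move/cvg_lim => <-//; rewrite lim_cst.
Qed.

End bump_limit.

(** * Weak derivatives tested on tensor products *)

Section test_factor.
Context {R : realType}.
Implicit Types eta : R -> R.

Definition bounded_support eta := exists M : R, forall s, M < `|s| -> eta s = 0.
Definition test_factor eta := smooth eta /\ bounded_support eta.

Lemma test_factor_bump n (a b : R) : test_factor (bump n a b).
Proof.
split; first exact: smooth_bump.
exists (Num.max `|a| `|b|) => s; rewrite gt_max => /andP[sa sb].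
apply: bump_out; rewrite in_itv/=; apply/negP => /andP[as_ bs].
have [s0|s0] := leP 0 s.
  by move: sb; rewrite (ger0_norm s0) ltNge (le_trans (ltW bs))// ler_norm.
move: sa; rewrite (ltr0_norm s0) ltNge; apply/negP/negPn.
by rewrite -normrN; apply: le_trans (ler_norm _); rewrite lerN2 ltW.
Qed.

Lemma test_factor_derive eta : test_factor eta -> test_factor (derive1 eta).
Proof.
move=> [seta [M HM]]; split; first exact: smooth_derive.
exists M => s Ms; rewrite derive1E.
have -> : 'D_1 eta s = 'D_1 (cst 0 : R -> R) s.
  apply: near_eq_derive => //.
  near=> y; apply: HM; near: y.
  have : {for s, continuous (@Num.Def.normr R R)} by exact: norm_continuous.
  by move=> /cvgr_gt; apply.
by rewrite derive_cst.
Unshelve. all: by end_near. Qed.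

Lemma test_factor_opp eta : test_factor eta -> test_factor (fun s => eta (- s)).
Proof.
move=> [seta [M HM]]; split.
  rewrite (_ : (fun _ => _) = fun s => eta (-1 * s + 0)).
    exact: smooth_comp_affine.
  by apply/funext => s; rewrite mulN1r addr0.
by exists M => s Ms; rewrite HM// normrN.
Qed.

Lemma derive1_opp eta s : smooth eta -> derive1 (fun s => eta (- s)) s = - derive1 eta (- s).
Proof.
move=> seta; rewrite derive1E.
have h1 := smooth_is_derive (- s) seta.
have h2 : is_derive s 1 (fun s : R => - s) (-1) by exact: is_deriveNid.
have [_ ->] := is_derive1_comp h1 h2.
by rewrite mulrN1.
Qed.

Lemma test_factor_bounded eta : test_factor eta ->
  exists N C, forall s, `|eta s| <= C * \1_(`]- N, N[%classic) s.
Proof.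
move=> [seta [M HM]]; pose N : R := `|M| + 1.
have N0 : 0 <= N by rewrite addr_ge0.
have cn : {within `[- N, N], continuous (fun s => `|eta s|)}.
  apply: continuous_subspaceT => s; apply: (@continuous_comp _ _ _ eta (@Num.Def.normr R R)).
    exact: smooth_continuous.
  exact: norm_continuous.
have [c _ Hc] := EVT_max (ge0_cp N0).2 cn.
exists N, `|eta c| => s; have [sN|sN] := boolP (s \in `]- N, N[).
  by rewrite indicE mem_set// mulr1 Hc// ; apply: subset_itv_oo_cc.
rewrite indicE memNset ?mulr0; last exact/negP.
rewrite HM ?normr0//; move: sN; rewrite in_itv/= -ltr_norml -leNgt; apply: lt_le_trans.
by rewrite /N; apply: le_lt_trans (ler_norm M) _; rewrite ltrDl.
Qed.

End test_factor.

Section tensor_sqint.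
Context {R : realType} {d : nat}.
Local Notation V := 'rV[R]_d.
Local Notation mu := (@lebesgue_rV R d).
Implicit Types eta : 'I_d -> R -> R.

Lemma indic_box_prod (a b : 'I_d -> R) (x : V) :
  \1_(box a b) x = \prod_(i < d) (\1_(`]a i, b i[%classic) (x ord0 i) : R) :> R.
Proof.
have [xab|xab] := pselect (box a b x).
  rewrite indicE mem_set// big1// => i _; rewrite indicE mem_set//; exact: xab.
rewrite indicE memNset//; move/existsNP : xab => [i xi].
by rewrite (bigD1 i)//= indicE memNset// mul0r.
Qed.

Lemma sqint_indic_box a b : sqint mu (\1_(box a b) : V -> R).
Proof.
split; first by apply: measurable_indic; exact: measurable_box.
rewrite (_ : (fun _ => _) = (\1_(box a b) : V -> R)); last first.
  by apply/funext => x; rewrite indicE; case: (x \in _); rewrite ?expr1n ?expr0n.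
apply/integrableP; split.
  by apply/measurable_EFinP; apply: measurable_indic; exact: measurable_box.
under eq_integral => x _ do rewrite gee0_abs ?lee_fin//.
rewrite integral_indic//; last exact: measurable_box.
rewrite setIT; exact: lebesgue_box_lty.
Qed.

Lemma sqint_box (H : V -> R) a b : sqint mu H -> mu.-integrable (box a b) (EFin \o H).
Proof.
move=> hH; apply/(integrable_mkcond _ (measurable_box a b)).
rewrite (_ : _ \_ _ = EFin \o (H \* \1_(box a b))).
  by apply: sqintM => //; exact: sqint_indic_box.
apply/funext => x; rewrite patchE /= indicE; case: ifPn => xab; by rewrite ?mulr1 ?mulr0.
Qed.

Lemma tensor_bounded eta : (forall i, test_factor (eta i)) ->
  exists a b C, forall x : V, `|tensor eta x| <= C * \1_(box a b) x.
Proof.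
move=> teta.
have /choice[N] : forall i, exists N C, forall s, `|eta i s| <= C * \1_(`]- N, N[%classic) s.
  by move=> i; exact: test_factor_bounded.
move=> /choice[C HC].
exists (fun i => - N i), N, (\prod_(i < d) C i) => x.
rewrite indic_box_prod -big_split/= /tensor normr_prod.
by apply: ler_prod => i _; rewrite normr_ge0 HC.
Qed.

Lemma sqint_tensor eta : (forall i, test_factor (eta i)) -> sqint mu (tensor eta).
Proof.
move=> teta; have [a [b [C HC]]] := tensor_bounded teta.
apply: (@le_sqint _ _ _ _ _ (fun x => C * \1_(box a b) x)).
- by apply: measurable_tensor => i; apply: measurable_smooth; case: (teta i).
- by move=> x; rewrite (le_trans (HC x))// ler_norm.
- by apply: sqintZ; exact: sqint_indic_box.
Qed.

Definition is_weak_partial_real (j : 'I_d) (f g : V -> R) := forall phi : V -> R,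
  test_function phi ->
  \int[mu]_x (f x * 'D_(unitv j) phi x) = - \int[mu]_x (g x * phi x).

Lemma is_weak_partial_real_tensor j f g eta :
  is_weak_partial_real j f g -> (forall i, test_factor (eta i)) ->
  \int[mu]_x (f x * tensor (subst_factor j (derive1 (eta j)) eta) x) =
  - \int[mu]_x (g x * tensor eta x).
Proof.
move=> w teta; have tt : test_function (tensor eta).
  by apply: test_function_tensor => i; have [] := teta i.
rewrite -(w _ tt).
apply: eq_Rintegral => x _; congr (_ * _).
by have [_ ->] := @is_derive_tensor R d j eta x (teta j).1.
Qed.

Lemma test_factor_subst j (h : R -> R) eta : test_factor h ->
  (forall i, test_factor (eta i)) -> forall i, test_factor (subst_factor j h eta i).
Proof. by move=> th teta i; rewrite /subst_factor; case: eqP. Qed.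

Lemma tensor_flip k eta (x : V) :
  tensor eta (flip_coord k x) = tensor (subst_factor k (fun s => eta k (- s)) eta) x.
Proof.
rewrite /tensor; apply: eq_bigr => i _; rewrite flip_coordE /subst_factor.
by case: eqP => [->|].
Qed.

(** Weak derivatives are unique almost everywhere, so they inherit the symmetry
    of f: the derivative along x_j is even in x_j and odd in the other
    coordinates.  With c = 1 if k = j and -1 otherwise, the tensor products,
    composed with the reflection, show that g o flip - c g is orthogonal to
    all bumps. *)
Lemma weak_partial_parity j k (f g : V -> R) :
  sqint mu f -> sqint mu g -> is_weak_partial_real j f g ->
  {ae mu, forall x, f (flip_coord k x) = - f x} ->
  {ae mu, forall x, g (flip_coord k x) = (if k == j then g x else - g x)}.
Proof.
move=> hf hg w of_.
pose c : R := if k == j then 1 else -1.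
have cc : c * c = 1 by rewrite /c; case: ifP => _; rewrite ?mulr1// mulrNN mulr1.
pose H x := g (flip_coord k x) - c * g x.
have pk := @preserves_flip R d k.
have hgk : sqint mu (g \o flip_coord k) by exact: sqint_preserves.
have hH : sqint mu H by apply: sqintB => //; exact: sqintZ.
suff : {ae mu, forall x, H x = 0}.
  apply: filterS => x; rewrite /H /c; case: ifP => _ /eqP; rewrite subr_eq0 => /eqP ->.
    by rewrite mul1r.
  by rewrite mulN1r.
have key eta : (forall i, test_factor (eta i)) -> \int[mu]_x (H x * tensor eta x) = 0.
  move=> teta.
  pose eta' := subst_factor k (fun s => eta k (- s)) eta.
  have teta' : forall i, test_factor (eta' i).
    by apply: test_factor_subst => //; exact: test_factor_opp.
  have sT := sqint_tensor teta.
  have sT' := sqint_tensor teta'.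
  pose D := tensor (subst_factor j (derive1 (eta j)) eta) : V -> R.
  have sD : sqint mu D.
    by apply: sqint_tensor; apply: test_factor_subst => //; exact: test_factor_derive.
  have E1 : \int[mu]_x (g (flip_coord k x) * tensor eta x) = c * \int[mu]_x (f x * D (flip_coord k x)).
    transitivity (\int[mu]_x (g x * tensor eta' x)).
      rewrite -(preserves_Rintegral pk (f := fun x => g x * tensor eta' x)); last exact: sqintM.
      apply: eq_Rintegral => x _; congr (_ * _).
      by rewrite -tensor_flip flip_coordK.
    apply/eqP; rewrite -eqr_opp -(is_weak_partial_real_tensor w teta'); apply/eqP.
    rewrite -mulNr -RintegralZl//; last first.
      apply: (sqintM hf); exact: (sqint_preserves pk sD).
    apply: eq_Rintegral => x _; rewrite mulrCA; congr (_ * _).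
    rewrite /D !tensor_subst mulrA; congr (_ * _).
      rewrite /eta' /subst_factor flip_coordE /c.
      have [->|jk] := eqVneq j k; last by rewrite opprK mul1r.
      by rewrite ?eqxx derive1_opp ?mulN1r//; case: (teta k).
    apply: eq_bigr => i _; rewrite /eta' /subst_factor flip_coordE.
    by case: eqP => [->|].
  have -> : \int[mu]_x (H x * tensor eta x) =
      \int[mu]_x (g (flip_coord k x) * tensor eta x) - c * \int[mu]_x (g x * tensor eta x).
    rewrite -RintegralZl//; last exact: sqintM.
    rewrite -RintegralB//; last 2 first.
    - by apply: (sqintM hgk).
    - by apply: intbleZ; exact: sqintM.
    by apply: eq_Rintegral => x _; rewrite /H mulrBl mulrA.
  rewrite E1 -mulrBr -[X in _ - X]opprK -(is_weak_partial_real_tensor w teta) opprK.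
  rewrite -[X in X + _](preserves_Rintegral pk (f := fun x => f x * D (flip_coord k x))); last first.
    by apply: (sqintM hf); exact: (sqint_preserves pk sD).
  under eq_Rintegral do rewrite flip_coordK.
  rewrite -RintegralD//; last 2 first.
  - by apply: (sqintM (sqint_preserves pk hf) sD).
  - exact: (sqintM hf sD).
  apply/eqP; rewrite mulf_eq0; apply/orP; right; apply/eqP.
  rewrite (ae_Rintegral (g := cst 0)) ?Rintegral_cst ?mul0r//.
  - apply: measurable_funD; apply: measurable_funM; try by case: sD.
      by case: (sqint_preserves pk hf).
    by case: hf.
  - by apply: filterS of_ => x ->; rewrite mulNr addNr.
apply: box_ae0; first by case: hH.
- by move=> a b; exact: sqint_box.
- move=> a b; apply: box_integral_eq0; [by case: hH|exact: sqint_box|].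
  by move=> n; apply: key => i; exact: test_factor_bump.
Qed.

End tensor_sqint.

(** * Primitives of bumps *)

Section bump_primitive.
Context {R : realType}.
Local Notation leb := (@lebesgue_measure R).
Variables (n : nat) (a b : R).
Local Notation eta := (bump n a b).

Lemma intble_bump : intble leb eta.
Proof.
apply: (@le_intble _ (measurableTypeR R) R leb eta (\1_(`]a, b[%classic))).
- by apply: measurable_smooth; exact: smooth_bump.
- move=> s; rewrite ger0_norm ?bump_ge0// indicE.
  have [sab|sab] := boolP (s \in `]a, b[); first by rewrite mem_set// bump_le1.
  by rewrite bump_out.
apply/integrableP; split; first by apply/measurable_EFinP; exact: measurable_indic.
under eq_integral => x _ do rewrite gee0_abs ?lee_fin//.
rewrite integral_indic// setIT.
suff : (leb (`]a, b[%classic : set R) < +oo)%E by [].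
by rewrite lebesgue_measure_itv/=; case: ifP => _; rewrite -?EFinB ltry.
Qed.

Lemma intble_bumpM (A : set R) : measurable A -> intble leb (fun t => eta t * \1_A t).
Proof.
move=> mA; apply: (intble_bounded (C := 1)); first exact: measurable_indic.
  by move=> t; rewrite indicE; case: (_ \in _); rewrite ?normr1 ?normr0.
exact: intble_bump.
Qed.

Definition primitive s : R := \int[leb]_t (eta t * \1_(`]-oo, s]%classic) t).
Definition mass : R := \int[leb]_t eta t.

Lemma is_derive_primitive (s : R) : is_derive s 1 primitive (eta s).
Proof.
have s1 : s < s + 1 by rewrite ltrDl.
have -> : primitive = (fun x => \int[leb]_(t in [set` Interval -oo%O (BRight x)]) eta t).
  apply/funext => x; rewrite [RHS]Rintegral_mkcond; apply: eq_Rintegral => t _.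
  by rewrite patchE indicE; case: (_ \in _); rewrite ?mulr1 ?mulr0.
have ib : leb.-integrable [set` Interval -oo%O (BRight (s + 1))] (EFin \o eta).
  by apply: integrableS intble_bump.
have ce : continuous eta by apply: smooth_continuous; exact: smooth_bump.
have [h1 h2] := @continuous_FTC1 R eta -oo%O s (s + 1) s1 ib (ltNyr _) (ce s).
by apply: DeriveDef => //; rewrite -derive1E h2.
Qed.

Lemma primitive_le s : s <= a -> primitive s = 0.
Proof.
move=> sa; rewrite /primitive (@eq_Rintegral _ _ _ leb setT (cst 0)) ?Rintegral_cst ?mul0r//.
move=> t _; rewrite indicE; have [ts|ts] := boolP (t \in _); last by rewrite mulr0.
rewrite mulr1 bump_out// in_itv/= negb_and -leNgt.
by move: ts; rewrite inE/= in_itv/= => ts; rewrite (le_trans ts sa).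
Qed.

Lemma primitive_ge s : b <= s -> primitive s = mass.
Proof.
move=> bs; apply: eq_Rintegral => t _; rewrite indicE.
have [ts|/negP ts] := boolP (t \in _); first by rewrite mulr1.
rewrite mulr0 bump_out// in_itv/= negb_and -!leNgt; apply/orP; right.
rewrite (le_trans bs)// leNgt; apply/negP => h; apply: ts.
by rewrite inE/= in_itv/= ltW.
Qed.

(** The mass to the right of s, written as an integral over r > 0 so that it
    becomes an integral along a ray. *)
Lemma mass_primitive s : mass - primitive s = \int[leb]_r (eta (s + r) * \1_(`]0, +oo[%classic) r).
Proof.
rewrite /mass /primitive -RintegralB//; last 2 first.
- exact: intble_bump.
- exact: intble_bumpM.
have pt := preserves_translation s.
transitivity (\int[leb]_t (eta t * \1_(`]s, +oo[%classic) t)).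
  apply: eq_Rintegral => t _; rewrite -[X in X - _]mulr1 -mulrBr; congr (_ * _).
  rewrite !indicE; have [ts|ts] := leP t s.
    by rewrite mem_set ?memNset/= ?in_itv/= ?subrr// andbT; apply/negP; rewrite -leNgt.
  by rewrite memNset ?mem_set/= ?in_itv/= ?subr0 ?andbT//; apply/negP; rewrite -ltNge.
rewrite -(preserves_Rintegral pt (f := fun t => eta t * \1_(`]s, +oo[%classic) t)); last first.
  exact: intble_bumpM.
apply: eq_Rintegral => t _; rewrite addrC; congr (_ * _).
rewrite !indicE; congr ((nat_of_bool _)%:R).
by apply/idP/idP; rewrite !inE/= !in_itv/= !andbT ltrDl.
Qed.

(** The even test factor with derivative eta(-s) - eta(s).  It has compact support
    because the primitive is 0 on the far left and constant on the far right, the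
    two contributions of an odd derivative cancelling each other. *)
Definition even_primitive s := mass - primitive s - primitive (- s).

Lemma is_derive_even_primitive (s : R) :
  is_derive s 1 even_primitive (eta (- s) - eta s).
Proof.
have h2 : is_derive s 1 (fun s : R => - s) (-1) by exact: is_deriveNid.
have h := @is_derive1_comp R primitive (fun s => - s) s _ _ (is_derive_primitive (- s)) h2.
have := is_deriveB (is_deriveB (is_derive_cst mass s 1) (is_derive_primitive s)) h.
rewrite (_ : 0 - eta s - _ = eta (- s) - eta s)//.
by rewrite mulrN1 opprK sub0r addrC.
Qed.

Lemma derive1_even_primitive : derive1 even_primitive = (fun s => eta (- s) - eta s).
Proof.
by apply/funext => s; rewrite derive1E; have [_ ->] := is_derive_even_primitive s.
Qed.

Lemma test_factor_even_primitive : 0 <= a -> test_factor even_primitive.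
Proof.
move=> a0; split.
  apply: smooth_antiderivative is_derive_even_primitive _.
  rewrite (_ : (fun _ => _) = (fun s => eta (-1 * s + 0)) \+ (cst (-1) \* eta)).
    apply: smooth_add; first by apply: smooth_comp_affine; exact: smooth_bump.
    by apply: smooth_mul; [exact: smooth_cst|exact: smooth_bump].
  by apply/funext => s /=; rewrite mulN1r addr0 mulN1r.
exists `|b| => s bs; rewrite /even_primitive.
have [s0|s0] := leP 0 s.
  have h1 : b <= s by rewrite (le_trans (ler_norm _))// -(ger0_norm s0) ltW.
  have h2 : - s <= a by rewrite (le_trans _ a0)// oppr_le0.
  by rewrite (primitive_ge h1) (primitive_le h2) subrr subr0.
have h1 : b <= - s by rewrite (le_trans (ler_norm _))// -(ltr0_norm s0) ltW.
have h2 : s <= a by rewrite (le_trans (ltW s0)).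
by rewrite (primitive_ge h1) (primitive_le h2) subr0 subrr.
Qed.

End bump_primitive.

(** * Fubini along lines *)

Section skew.
Context {R : realType} {d : nat}.
Local Notation V := 'rV[R]_d.
Local Notation mu := (@lebesgue_rV R d).
Local Notation leb := (@lebesgue_measure R).
Local Notation VR := (V * measurableTypeR R)%type.
Local Notation mul := (mu \x leb)%E.

(** A shear of the product of the space with the line of step lengths.  Its
    invariance is Fubini's theorem combined with translation invariance, and it
    trades a function translated by r for a test function translated by -r. *)
Definition skew (j : 'I_d) (z : VR) : VR := (slide j (- z.2) z.1, z.2).

Lemma measurable_skew j : measurable_fun setT (skew j).
Proof.
apply/measurable_fun_pairP; split => /=; last exact: measurable_snd.
apply: measurable_fun_rV => i; rewrite /comp /rV_coord.
rewrite (_ : (fun _ => _) = fun z : VR => z.1 ord0 i + (if i == j then - z.2 else 0)).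
  apply: measurable_funD; first exact: measurableT_comp (measurable_coord i) measurable_fst.
  by case: eqP => _ //; apply: measurableT_comp => //; exact: measurable_snd.
by apply/funext => z /=; rewrite slide_coord.
Qed.

Lemma preserves_skew j : preserves mul (skew j).
Proof.
split=> [|A mA]; first exact: measurable_skew.
have mS : measurable (skew j @^-1` A).
  by rewrite -[X in measurable X]setTI; exact: measurable_skew.
have E B : measurable B -> mul B = (\int[leb]_r \int[mu]_x (\1_B (x, r))%:E)%E.
  move=> mB; have := integral_indic mul measurableT mB; rewrite setIT => <-.
  rewrite fubini_tonelli2//.
  by apply/measurable_EFinP; exact: measurable_indic.
apply: (etrans (E _ mS)); apply: esym; apply: (etrans (E _ mA)); apply: esym.
apply: eq_integral => r _.
rewrite -(preserves_ge0_integral (preserves_slide j (- r)) (f := fun x => (\1_A (x, r))%:E))//.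
apply/measurable_EFinP; apply: measurableT_comp; first exact: measurable_indic.
exact: measurable_pair2.
Qed.

End skew.

Section fubini_real.
Context d1 d2 (T1 : measurableType d1) (T2 : measurableType d2) (R : realType).
Variables (m1 : {sigma_finite_measure set T1 -> \bar R}).
Variables (m2 : {sigma_finite_measure set T2 -> \bar R}).
Variable K : T1 * T2 -> R.

Lemma measurable_Rintegral2 : measurable_fun setT K ->
  measurable_fun setT (fun x => \int[m2]_y K (x, y)).
Proof.
move=> mK; have mK' : measurable_fun setT (EFin \o K) by exact/measurable_EFinP.
apply: measurableT_comp => //.
rewrite (_ : (fun x => _) = (fun x => (\int[m2]_y (EFin \o K)^\+ (x, y) -
    \int[m2]_y (EFin \o K)^\- (x, y))%E)).
  apply: emeasurable_funB; apply: measurable_fun_fubini_tonelli_F => //.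
    exact: measurable_funepos.
  exact: measurable_funeneg.
apply/funext => x; rewrite integralE.
by congr (_ - _)%E; apply: eq_integral => y _; rewrite ?funeposE ?funenegE.
Qed.

Hypothesis iK : intble (m1 \x m2)%E K.

Let finK : {ae m1, forall x, (\int[m2]_y K (x, y))%:E = (\int[m2]_y (K (x, y))%:E)%E}.
Proof.
have := ae_integrable1 iK; apply: filterS => x hx.
by rewrite fineK//; exact: integrable_fin_num.
Qed.

Let mE : measurable_fun setT (fun x => (\int[m2]_y (K (x, y))%:E)%E).
Proof. exact: measurable_int (integrable_fubini_F iK). Qed.

Lemma intble_Rintegral2 : intble m1 (fun x => \int[m2]_y K (x, y)).
Proof.
have /integrableP[h1 h2] := integrable_fubini_F iK.
apply/integrableP; split.
  by apply/measurable_EFinP; apply: measurable_Rintegral2; exact: intble_measurable iK.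
apply: le_lt_trans h2; rewrite le_eqVlt; apply/orP; left; apply/eqP.
apply: ae_eq_integral => //; do ?exact: measurableT_comp.
  apply: measurableT_comp => //; apply/measurable_EFinP; apply: measurable_Rintegral2.
  exact: intble_measurable iK.
by apply: filterS finK => x hx _; rewrite /comp hx.
Qed.

Lemma Rintegral_fubini : \int[m1]_x \int[m2]_y K (x, y) = \int[(m1 \x m2)%E]_z K z.
Proof.
rewrite /Rintegral; congr fine; rewrite -integral12_prod_meas1//.
apply: ae_eq_integral => //.
- apply/measurable_EFinP; apply: measurable_Rintegral2.
  exact: intble_measurable iK.
- by apply: filterS finK => x /= ->.
Qed.

End fubini_real.

Section half.
Context {R : realType} {d : nat}.
Local Notation V := 'rV[R]_d.
Local Notation mu := (@lebesgue_rV R d).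
Local Notation leb := (@lebesgue_measure R).
Local Notation mul := (mu \x leb)%E.
Implicit Types (h u : V -> R).

Definition half (j : 'I_d) h (x : V) : R := h x * (0 < x ord0 j)%R%:R.

Lemma measurable_half j h : measurable_fun setT h -> measurable_fun setT (half j h).
Proof.
move=> mh; apply: measurable_funM => //.
rewrite (_ : (fun _ => _) = (\1_(`]0, +oo[%classic) : R -> R) \o (fun x : V => x ord0 j)).
  by apply: measurableT_comp; [exact: measurable_indic|exact: measurable_coord].
apply/funext => x /=; rewrite indicE; congr ((nat_of_bool _)%:R).
by apply/idP/idP; rewrite inE/= in_itv/= andbT.
Qed.

Lemma half_norm j h x : `|half j h x| <= `|h x|.
Proof. by rewrite /half normrM; case: (0 < _); rewrite ?normr1 ?normr0 ?mulr1 ?mulr0. Qed.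

Lemma sqint_half j h : sqint mu h -> sqint mu (half j h).
Proof.
move=> hh; apply: (le_sqint _ _ hh); last exact: half_norm.
by apply: measurable_half; case: hh.
Qed.

Lemma intble_half j h : intble mu h -> intble mu (half j h).
Proof.
move=> hh; apply: (le_intble _ _ (integrable_norm hh)); last exact: half_norm.
by apply: measurable_half; exact: intble_measurable hh.
Qed.

(** Reflections exchange the two half-spaces; the hyperplane between them has
    measure 0 and can be ignored. *)
Lemma ae_off_hyperplane (j : 'I_d) : {ae mu, forall x : V, x ord0 j != 0}.
Proof.
exists [set x : V | x ord0 j = 0]; split.
- rewrite (_ : mkset _ = (fun x : V => x ord0 j) @^-1` [set 0]) //.
  by rewrite -[X in measurable X]setTI; exact: measurable_coord.
- exact: hyperplane0.
- by move=> x /= /negP; rewrite negbK => /eqP.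
Qed.

Lemma Rintegral_even j h : intble mu h ->
  {ae mu, forall x, h (flip_coord j x) = h x} ->
  \int[mu]_x h x = 2 * \int[mu]_x half j h x.
Proof.
move=> hh eh; have ih := intble_half j hh.
have pj := @preserves_flip R d j.
have ihf := preserves_integrable pj ih.
rewrite -[2]/(1 + 1 : R) mulrDl mul1r -[X in _ + X](preserves_Rintegral pj ih) -RintegralD//.
apply: ae_Rintegral.
- exact: intble_measurable hh.
- by apply: measurable_funD; [exact: intble_measurable ih|exact: intble_measurable ihf].
apply: filterS2 eh (ae_off_hyperplane j) => x hx xj.
rewrite /half flip_coordE eqxx oppr_gt0 hx.
by case: ltgtP xj => // _ _; rewrite ?mulr1 ?mulr0 ?addr0 ?add0r.
Qed.

Lemma slideK j r : cancel (slide j (- r)) (slide j r : V -> V).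
Proof.
move=> x; apply/rowP => i; rewrite !slide_coord; case: eqP => _; rewrite ?addr0//.
by rewrite subrK.
Qed.

Lemma intble_tensor_prod (h : V -> R) (k : R -> R) : intble mu h -> intble leb k ->
  intble mul (fun z : V * measurableTypeR R => h z.1 * k z.2).
Proof.
move=> hh hk; have mh := intble_measurable hh; have mk := intble_measurable hk.
have mhk : measurable_fun setT (fun z : V * measurableTypeR R => h z.1 * k z.2).
  by apply: measurable_funM; [exact: measurableT_comp mh measurable_fst|
    exact: measurableT_comp mk measurable_snd].
apply/integrable12ltyP; first exact/measurable_EFinP.
have /integrableP[_ kfin] := hk; have /integrableP[_ hfin] := hh.
have E x : (\int[leb]_r `|(h x * k r)%:E| = `|h x|%:E * \int[leb]_r `|(k r)%:E|)%E.
  rewrite -ge0_integralZl//; last first.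
    by apply: measurableT_comp => //; exact/measurable_EFinP.
  by apply: eq_integral => r _; rewrite /= normrM EFinM.
under eq_integral do rewrite /= E.
rewrite ge0_integralZr//; last 2 first.
- by apply/measurable_EFinP; apply: measurableT_comp.
- exact: integral_ge0.
by rewrite lte_mul_pinfty//; [exact: integral_ge0|rewrite ge0_fin_numE//; exact: integral_ge0].
Qed.

Lemma intble_indic (A : set R) : measurable (A : set (measurableTypeR R)) ->
  (leb A < +oo)%E -> intble leb (\1_A : R -> R).
Proof.
move=> mA Aoo; apply/integrableP; split; first by apply/measurable_EFinP; exact: measurable_indic.
under eq_integral => x _ do rewrite gee0_abs ?lee_fin//.
by rewrite integral_indic// setIT.
Qed.

Lemma leb_itvoo_lty (a b : R) : (leb (`]a, b[%classic : set R) < +oo)%E.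
Proof. by rewrite lebesgue_measure_itv/=; case: ifP => _; rewrite -?EFinB ltry. Qed.

Lemma line_sqint j u (A : set R) : sqint mu u -> measurable (A : set (measurableTypeR R)) ->
  (leb A < +oo)%E ->
  intble mul (fun z : V * measurableTypeR R => u (slide j (- z.2) z.1) ^+ 2 * \1_A z.2).
Proof.
move=> [mu_ hu] mA Aoo.
have h := intble_tensor_prod hu (intble_indic mA Aoo).
exact: (preserves_integrable (@preserves_skew R d j) h).
Qed.

Lemma measurable_line j u : measurable_fun setT u ->
  measurable_fun setT (fun z : V * measurableTypeR R => u (slide j (- z.2) z.1)).
Proof.
move=> mu_; apply: (measurableT_comp mu_).
exact: measurableT_comp measurable_fst (@measurable_skew R d j).
Qed.

(** Fubini for the square of u shows that u is square-integrable on bounded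
    pieces of almost every line; those pieces have finite length, so u is
    integrable there. *)
Lemma line_intble j u : sqint mu u ->
  {ae mu, forall x, forall N : nat,
     intble leb (fun r : R => u (slide j (- r) x) * \1_(`]- N%:R, N%:R[%classic) r)}.
Proof.
move=> hu; apply/ae_foralln => N.
have mA : measurable (`]- N%:R, N%:R[%classic : set (measurableTypeR R)) by exact: measurable_itv.
have iA := intble_indic mA (leb_itvoo_lty _ _).
have h := line_sqint j hu mA (leb_itvoo_lty _ _).
have := ae_integrable1 h; apply: filterS => x hx.
apply: (@le_intble _ _ _ leb _ (fun r => u (slide j (- r) x) ^+ 2 * \1_(`]- N%:R, N%:R[%classic) r
   + \1_(`]- N%:R, N%:R[%classic) r)).
- apply: measurable_funM; last exact: measurable_indic.
  exact: (measurableT_comp (measurable_line j (proj1 hu)) (measurable_pair1 x)).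
- move=> r; rewrite indicE; case: (_ \in _); last by rewrite !mulr0 normr0 addr0.
  rewrite !mulr1; set v := u _.
  rewrite -[true%:R]/(1 : R) -(real_normK (num_real v)).
  by have := normr_ge0 v; have := sqr_ge0 (`|v| - 1); nra.
- exact: intbleD.
Qed.

(** Against the direction of x_j a line leaves the half-space, so only a bounded
    piece of it matters. *)
Lemma half_line_intble j u : sqint mu u ->
  {ae mu, forall x, forall c : R,
     intble leb (fun r : R => half j u (slide j (- r) x) * \1_(`]c, +oo[%classic) r)}.
Proof.
move=> hu; have := line_intble j (sqint_half j hu); apply: filterS => x hx c.
pose M := Num.max `|c| `|x ord0 j|; pose N := (Num.truncn M).+1.
have MN : M < N%:R by exact: truncnS_gt.
have [cN xN] : `|c| < N%:R /\ `|x ord0 j| < N%:R.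
  by move: MN; rewrite gt_max => /andP[].
have mic : measurable_fun setT (\1_(`]c, +oo[%classic) : measurableTypeR R -> R).
  by apply: measurable_indic; exact: measurable_itv.
have := intble_bounded (C := 1) mic _ (hx N).
have h1 r : `|\1_(`]c, +oo[%classic) r : R| <= 1.
  by rewrite indicE; case: (_ \in _); rewrite ?normr1 ?normr0.
move=> /(_ h1); apply: eq_integrable => // r _; congr EFin.
rewrite /= !indicE; have [rc|rc] := boolP (r \in `]c, +oo[%classic); last by rewrite !mulr0.
rewrite !mulr1 /half slide_coord eqxx subr_gt0.
have [rx|rx] := ltP r (x ord0 j); last by rewrite !mulr0 mul0r.
rewrite mem_set ?mulr1//= in_itv/=; move: rc; rewrite inE/= in_itv/= andbT => rc.
rewrite (lt_trans _ rc)/=; last by rewrite ltrNl (le_lt_trans _ cN)// -normrN ler_norm.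
by rewrite (lt_trans rx)// (le_lt_trans _ xN)// ler_norm.
Qed.

(** The integral of u along the half-line that starts at x and goes back against
    the j-th axis: for u supported in the half-space x_j > 0 and u a derivative
    along x_j, this is the candidate primitive vanishing on the hyperplane. *)
Definition ray (j : 'I_d) u (x : V) : R :=
  \int[leb]_r (u (slide j (- r) x) * \1_(`]0, +oo[%classic) r).

Lemma measurable_ray j u : measurable_fun setT u -> measurable_fun setT (ray j u).
Proof.
move=> mu_; rewrite /ray.
apply: (@measurable_Rintegral2 _ _ _ _ R leb
  (fun z : V * measurableTypeR R => u (slide j (- z.2) z.1) * \1_(`]0, +oo[%classic) z.2)).
apply: measurable_funM; first exact: measurable_line.
by apply: measurableT_comp => //; apply: measurable_indic; exact: measurable_itv.
Qed.

Section ray_swap.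
Variables (j : 'I_d) (u : V -> R) (hu : sqint mu u) (a b : 'I_d -> R) (chi : V -> R).
Hypotheses (mchi : measurable_fun setT chi) (chi1 : forall x, `|chi x| <= \1_(box a b) x).

Let K (z : V * measurableTypeR R) : R :=
  half j u z.1 * chi (slide j z.2 z.1) * \1_(`]0, +oo[%classic) z.2.

Let a' i := if i == j then 0 else a i.

Let measurable_chi_slide :
  measurable_fun setT (fun z : V * measurableTypeR R => chi (slide j z.2 z.1)).
Proof.
rewrite (_ : (fun _ => _) = (fun z => chi (slide j (- - z.2) z.1))); last first.
  by apply/funext => z; rewrite opprK.
have m := measurable_line j mchi.
apply: (measurableT_comp m (g := fun z : V * measurableTypeR R => (z.1, - z.2 : measurableTypeR R))).
apply/measurable_fun_pairP; split => //=; first exact: measurable_fst.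
exact: (measurableT_comp (@oppr_measurable R setT) measurable_snd).
Qed.

Let intble_chi_slide x :
  intble leb (fun r => chi (slide j r x) * \1_(`]0, +oo[%classic) r).
Proof.
have mA : measurable (`]a j - x ord0 j, b j - x ord0 j[%classic : set (measurableTypeR R)).
  exact: measurable_itv.
have iA := intble_indic mA (leb_itvoo_lty _ _).
apply: (@le_intble _ (measurableTypeR R) R leb
    (fun r => chi (slide j r x) * \1_(`]0, +oo[%classic) r) _ _ _ iA).
  apply: measurable_funM; last by apply: measurable_indic; exact: measurable_itv.
  exact: (measurableT_comp measurable_chi_slide (measurable_pair1 x)).
move=> r; rewrite normrM [`|\1__ _|]ger0_norm//.
apply: (@le_trans _ _ (\1_(box a b) (slide j r x))).
  apply: le_trans (chi1 _); by rewrite -[leRHS]mulr1 ler_wpM2l//.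
rewrite indicE; case: (boolP (_ \in _)) => // /set_mem /(_ j).
rewrite /= slide_coord eqxx in_itv/= => /andP[h1 h2].
by rewrite indicE mem_set//= in_itv/= ltrBlDl ltrBrDl h1 h2.
Qed.

Let intbleK : intble mul K.
Proof.
have h0 : intble mu (fun x => `|u x| * \1_(box a' b) x).
  apply: sqintM; last exact: sqint_indic_box.
  apply: (le_sqint _ _ hu); last by move=> x; rewrite normr_id.
  by apply: measurableT_comp => //; case: hu.
have mA : measurable (`]0, b j[%classic : set (measurableTypeR R)) by exact: measurable_itv.
have h := intble_tensor_prod h0 (intble_indic mA (leb_itvoo_lty _ _)).
apply: (le_intble _ _ h).
- apply: measurable_funM; last first.
    by apply: measurableT_comp => //; apply: measurable_indic; exact: measurable_itv.
  apply: measurable_funM.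
    by apply: measurableT_comp measurable_fst; apply: measurable_half; case: hu.
  exact: measurable_chi_slide.
move=> [x r] /=; rewrite /K /= /half !indicE.
have [r0|r0] := boolP (r \in `]0, +oo[%classic); last first.
  by rewrite mulr0 normr0 !mulr_ge0.
have [x0|x0] := ltP 0 (x ord0 j); last first.
  by rewrite mulr0 !mul0r normr0 !mulr_ge0.
rewrite !mulr1 normrM -mulrA ler_wpM2l//; apply: le_trans (chi1 _) _; rewrite indicE.
have [hb|hb] := boolP (slide j r x \in box a b); last by rewrite mulr_ge0.
move: r0; rewrite inE/= in_itv/= andbT => r0; move: hb; rewrite inE => hb.
have /= := hb j; rewrite slide_coord eqxx in_itv/= => /andP[_ xrb].
rewrite !mem_set ?mulr1//=.
  by rewrite in_itv/= r0 (lt_trans _ xrb)// ltrDr.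
move=> i /=; have := hb i; rewrite slide_coord /a'; case: eqP => [->|_]; last by rewrite addr0.
by move=> _; rewrite /= in_itv/= x0 (lt_trans _ xrb)// ltrDl.
Qed.

Let mulK := preserves_integrable (@preserves_skew R d j) intbleK.

Let Kskew : {ae mu, forall x, \int[leb]_r K (skew j (x, r)) = ray j (half j u) x * chi x}.
Proof.
have := half_line_intble j hu; apply: filterS => x hx.
rewrite /ray -RintegralZr//; apply: eq_Rintegral => r _.
by rewrite /K /skew /= slideK mulrAC.
Qed.

Let mray : measurable_fun setT (fun x => ray j (half j u) x * chi x).
Proof.
apply: measurable_funM => //; apply: measurable_ray; apply: measurable_half.
by case: hu.
Qed.

Lemma intble_ray : intble mu (fun x => ray j (half j u) x * chi x).
Proof. exact: (ae_intble mray Kskew (intble_Rintegral2 mulK)). Qed.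

(** Integration along rays is the transpose of integration against a test
    function along the opposite rays. *)
Lemma Rintegral_ray :
  \int[mu]_x (ray j (half j u) x * chi x) =
  \int[mu]_x (half j u x * \int[leb]_r (chi (slide j r x) * \1_(`]0, +oo[%classic) r)).
Proof.
rewrite -(ae_Rintegral _ mray Kskew); last first.
  exact: intble_measurable (intble_Rintegral2 mulK).
rewrite (Rintegral_fubini mulK) (preserves_Rintegral (@preserves_skew R d j) intbleK).
rewrite -(Rintegral_fubini intbleK); apply: ae_Rintegral.
- exact: intble_measurable (intble_Rintegral2 intbleK).
- apply: measurable_funM; first by apply: measurable_half; case: hu.
  apply: (@measurable_Rintegral2 _ _ _ _ R leb
    (fun z : V * measurableTypeR R => chi (slide j z.2 z.1) * \1_(`]0, +oo[%classic) z.2)).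
  apply: measurable_funM => //.
  by apply: measurableT_comp => //; apply: measurable_indic; exact: measurable_itv.
- apply: aeW => x; rewrite -RintegralZl//; apply: eq_Rintegral => r _.
  by rewrite /K /= mulrA.
Qed.

End ray_swap.

End half.

(** * An odd function is the integral of its weak derivative *)

Section ray_identity.
Context {R : realType} {d : nat}.
Local Notation V := 'rV[R]_d.
Local Notation mu := (@lebesgue_rV R d).
Local Notation leb := (@lebesgue_measure R).
Variables (j : 'I_d) (f g : V -> R).
Hypotheses (hf : sqint mu f) (hg : sqint mu g) (w : is_weak_partial_real j f g).
Hypothesis f_odd : {ae mu, forall x, f (flip_coord j x) = - f x}.
Hypothesis g_even : {ae mu, forall x, g (flip_coord j x) = g x}.

Let pj := @preserves_flip R d j.

Lemma bumps_indic n (a b : 'I_d -> R) x : `|bumps n a b x| <= \1_(@box R d a b) x.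
Proof.
rewrite ger0_norm ?bumps_ge0// indicE.
have [xab|xab] := pselect (box a b x); first by rewrite mem_set// bumps_le1.
by rewrite bumps_out.
Qed.

(** The oddness of f enters here.  Testing the weak derivative on the even
    function [even_primitive] in x_j, whose derivative is eta(-s) - eta(s), gives
    twice the integral of f against the bump on the left and, by evenness of g,
    twice a half-space integral on the right.  No boundary term at x_j = 0 arises:
    this is the weak form of f vanishing on the hyperplane. *)
Lemma ray_bump n (a b : 'I_d -> R) : 0 <= a j ->
  \int[mu]_x (half j f x * bumps n a b x) =
  \int[mu]_x (ray j (half j g) x * bumps n a b x).
Proof.
move=> a0; pose B : V -> R := bumps n a b.
pose eta (i : 'I_d) := bump n (a i) (b i).
pose theta := even_primitive n (a j) (b j).
pose eta1 := subst_factor j theta eta.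
have teta1 i : test_factor (eta1 i).
  apply: test_factor_subst; first exact: test_factor_even_primitive.
  by move=> k; exact: test_factor_bump.
have sB : sqint mu B by apply: sqint_tensor => i; exact: test_factor_bump.
have sBf : sqint mu (B \o flip_coord j) by exact: sqint_preserves.
pose T : V -> R := tensor eta1.
have sT : sqint mu T by exact: sqint_tensor.
have TE x : T x = theta (x ord0 j) * \prod_(i < d | i != j) eta i (x ord0 i).
  by rewrite /T /eta1 tensor_subst.
have E1 : \int[mu]_x (f x * (B (flip_coord j x) - B x)) = - \int[mu]_x (g x * T x).
  rewrite -(is_weak_partial_real_tensor w teta1); apply: eq_Rintegral => x _; congr (_ * _).
  rewrite tensor_subst {1}/eta1 /subst_factor eqxx derive1_even_primitive mulrBl.
  congr (_ - _).
    rewrite /B /bumps (tensorD1 j) flip_coordE eqxx; congr (_ * _).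
    by apply: eq_bigr => i /negbTE ij; rewrite flip_coordE /eta1 /subst_factor ij.
  rewrite /B /bumps (tensorD1 j); congr (_ * _).
  by apply: eq_bigr => i /negbTE ij; rewrite /eta1 /subst_factor ij.
have ifB : intble mu (fun x => f x * B x) by exact: sqintM.
have igT : intble mu (fun x => g x * T x) by exact: sqintM.
have E2 : \int[mu]_x (f x * (B (flip_coord j x) - B x)) = - (2 * \int[mu]_x (f x * B x)).
  have iffB : intble mu (fun x => f x * B (flip_coord j x)) by exact: (sqintM hf sBf).
  under eq_Rintegral do rewrite mulrBr.
  rewrite RintegralB// -[X in X - _](preserves_Rintegral pj iffB).
  rewrite [X in X - _](_ : _ = - \int[mu]_x (f x * B x)); last first.
    rewrite -mulN1r -RintegralZl//; apply: ae_Rintegral.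
    - exact: intble_measurable (preserves_integrable pj iffB).
    - by apply: measurable_funM => //; exact: intble_measurable ifB.
    - by apply: filterS f_odd => x ->; rewrite flip_coordK mulN1r mulNr.
  ring.
have E3 : \int[mu]_x (f x * B x) = \int[mu]_x half j (fun x => g x * T x) x.
  have Teven x : T (flip_coord j x) = T x.
    rewrite !TE; congr (_ * _); last first.
      by apply: eq_bigr => i /negbTE ij; rewrite flip_coordE ij.
    by rewrite flip_coordE eqxx /theta /even_primitive opprK addrAC.
  have := Rintegral_even igT; rewrite -[\int[mu]_x (g x * T x)]opprK -E1 E2 opprK => e.
  have ge : {ae mu, forall x, g (flip_coord j x) * T (flip_coord j x) = g x * T x}.
    by apply: filterS g_even => x ->; rewrite Teven.
  by have := e j ge; lra.
have -> : \int[mu]_x (half j f x * bumps n a b x) = \int[mu]_x (f x * B x).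
  apply: eq_Rintegral => x _; rewrite /half -/B; have [x0|x0] := ltP 0 (x ord0 j).
    by rewrite mulr1.
  rewrite mulr0 mul0r /B bumps_out ?mulr0// => /(_ j) /=.
  by rewrite in_itv/= => /andP[ax _]; move: (le_lt_trans a0 ax); rewrite ltNge x0.
rewrite E3 (Rintegral_ray j hg (measurable_bumps _ _ _) (bumps_indic n a b)).
apply: eq_Rintegral => x _; rewrite /half.
have [x0|x0] := ltP 0 (x ord0 j); last by rewrite !mulr0 mul0r.
rewrite !mulr1; congr (_ * _); rewrite TE.
have -> : theta (x ord0 j) = mass n (a j) (b j) - primitive n (a j) (b j) (x ord0 j).
  rewrite /theta /even_primitive [X in _ - X]primitive_le ?subr0//.
  by rewrite (le_trans _ a0)// oppr_le0 ltW.
rewrite mass_primitive -RintegralZr//.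
  apply: eq_Rintegral => r _; rewrite mulrAC; congr (_ * _).
  rewrite /bumps (tensorD1 j) slide_coord eqxx; congr (_ * _).
  by apply: eq_bigr => i /negbTE ij; rewrite slide_coord ij addr0.
apply: (intble_bounded (C := 1)); first by apply: measurable_indic; exact: measurable_itv.
  by move=> r; rewrite indicE; case: (_ \in _); rewrite ?normr1 ?normr0.
have pt := preserves_translation (x ord0 j).
have := preserves_integrable pt (intble_bump n (a j) (b j)).
by apply: eq_integrable => // r _; rewrite /= addrC.
Qed.

(** On the half-space x_j <= 0 both sides vanish, so boxes can be cut down to
    those with a_j >= 0, for which [ray_bump] applies. *)
Lemma ray_identity : {ae mu, forall x, half j f x = ray j (half j g) x}.
Proof.
pose H x := half j f x - ray j (half j g) x.
suff : {ae mu, forall x, H x = 0}.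
  by apply: filterS => x /eqP; rewrite subr_eq0 => /eqP.
have mray : measurable_fun setT (ray j (half j g)).
  by apply: measurable_ray; apply: measurable_half; case: hg.
have mH : measurable_fun setT H.
  by apply: measurable_funB => //; apply: measurable_half; case: hf.
have chi1 a b x : `|\1_(box a b) x : R| <= \1_(@box R d a b) x by rewrite ger0_norm.
have mchi a b : measurable_fun setT (\1_(box a b) : V -> R).
  by apply: measurable_indic; exact: measurable_box.
have iray a b : mu.-integrable (box a b) (EFin \o ray j (half j g)).
  apply/(integrable_mkcond _ (measurable_box a b)).
  have := intble_ray j hg (mchi a b) (chi1 a b).
  apply: eq_integrable => // x _; rewrite patchE /= indicE.
  by case: ifPn => xab; rewrite ?mulr1 ?mulr0.
have ihalf a b : mu.-integrable (box a b) (EFin \o half j f).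
  by apply: sqint_box; exact: sqint_half.
have iH a b : mu.-integrable (box a b) (EFin \o H).
  exact: (integrableB (measurable_box a b) (ihalf a b) (iray a b)).
apply: box_ae0 => // a b.
pose a' i := if i == j then Num.max (a j) 0 else a i.
have -> : (\int[mu]_(x in box a b) (H x)%:E = \int[mu]_(x in box a' b) (H x)%:E)%E.
  rewrite integral_mkcond [RHS]integral_mkcond; apply: eq_integral => x _.
  rewrite !patchE; have [x0|x0] := ltP 0 (x ord0 j).
    congr (if _ then _ else _); apply/idP/idP; rewrite !inE => h i; have := h i;
      rewrite /a' /=; case: eqP => [->|//]; rewrite !in_itv/= ?gt_max ?x0 ?andbT//.
  have -> : H x = 0.
    rewrite /H /half ltNge x0/= mulr0 sub0r /ray (@eq_Rintegral _ _ _ leb setT (cst 0)).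
      by rewrite Rintegral_cst// mul0r oppr0.
    move=> r _; rewrite indicE slide_coord eqxx subr_gt0.
    have [/set_mem/=|_] := boolP (r \in _); last by rewrite mulr0.
    rewrite in_itv/= andbT => r0.
    by rewrite ltNge (le_trans x0 (ltW r0)) mulr0 mul0r.
  by rewrite !if_same.
apply: box_integral_eq0 => // n.
under eq_Rintegral do rewrite mulrBl.
have sB : sqint mu (bumps n a' b) by apply: sqint_tensor => i; exact: test_factor_bump.
rewrite RintegralB//.
- rewrite ray_bump ?subrr// /a' eqxx le_max lexx orbT//.
- by apply: sqintM => //; exact: sqint_half.
- by apply: intble_ray => //; [exact: measurable_bumps|exact: bumps_indic].
Qed.

End ray_identity.

(** * Difference quotients *)

Section difference.
Context {R : realType} {d : nat}.
Local Notation V := 'rV[R]_d.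
Local Notation mu := (@lebesgue_rV R d).
Local Notation leb := (@lebesgue_measure R).
Local Notation mul := (mu \x leb)%E.
Implicit Types (k : V -> R).

Lemma Rintegral_tensor_prod (h : V -> R) (k : R -> R) : intble mu h -> intble leb k ->
  \int[mul]_z (h z.1 * k z.2) = \int[mu]_x h x * \int[leb]_r k r.
Proof.
move=> hh hk; rewrite -(Rintegral_fubini (intble_tensor_prod hh hk))/=.
under eq_Rintegral do rewrite RintegralZl//.
by rewrite RintegralZr.
Qed.

Variables (j : 'I_d) (u g : V -> R).
Let v := half j g.
Hypotheses (hu : sqint mu u) (hg : sqint mu g).
Hypothesis uv : {ae mu, forall x, u x = ray j v x}.
Variables (h : R) (h0 : 0 < h).

Let A : set R := `]- h, 0]%classic.

Let mA : measurable (A : set (measurableTypeR R)). Proof. exact: measurable_itv. Qed.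

Let lebA : leb A = h%:E.
Proof. by rewrite lebesgue_measure_itv/= lte_fin oppr_lt0 h0 -EFinB sub0r opprK. Qed.

Let iA : intble leb (\1_A : R -> R).
Proof. by apply: intble_indic => //; have := ltry h; rewrite -lebA. Qed.

Let IA : \int[leb]_r \1_A r = h.
Proof.
by rewrite /Rintegral integral_indic// setIT; have := congr1 fine lebA.
Qed.

Lemma slide_slide r s (x : V) : slide j r (slide j s x) = slide j (r + s) x.
Proof.
apply/rowP => i; rewrite !slide_coord; case: eqP => _; last by rewrite !addr0.
by rewrite -addrA (addrC s).
Qed.

(** The two rays that start at x and at x + h e_j differ by a segment of length
    h.  The integrability of v along the segment is recorded as well since it is
    needed to use the identity. *)
Lemma difference_identity : {ae mu, forall x,
  intble leb (fun r => v (slide j (- r) x) * \1_A r) /\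
  u (slide j h x) - u x = \int[leb]_r (v (slide j (- r) x) * \1_A r)}.
Proof.
have uv' := preserves_ae (@preserves_slide R d j h) uv.
have hl := half_line_intble j hg.
apply: filterS3 uv uv' hl => x -> -> hx.
have ih := hx (- h); have i0 := hx 0.
have E r : v (slide j (- r) x) * \1_A r =
    v (slide j (- r) x) * \1_(`]- h, +oo[%classic) r - v (slide j (- r) x) * \1_(`]0, +oo[%classic) r.
  rewrite -mulrBr; congr (_ * _); rewrite !indicE /A.
  have [r0|r0] := ltP 0 r.
    rewrite (memNset (A := `]- h, 0]%classic)); last by rewrite /= in_itv/= leNgt r0 andbF.
    rewrite !mem_set/= ?in_itv/= ?r0 ?andbT ?subrr//.
    by rewrite (lt_trans _ r0)// oppr_lt0.
  rewrite (memNset (A := `]0, +oo[%classic)); last by rewrite /= in_itv/= ltNge r0.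
  rewrite subr0; congr ((nat_of_bool _)%:R).
  by apply/idP/idP; rewrite !inE/= !in_itv/= r0 andbT.
split.
  by apply: eq_integrable (intbleB ih i0) => // r _; rewrite /= E.
under [RHS]eq_Rintegral do rewrite E.
rewrite RintegralB//; congr (_ - _).
have pt := preserves_translation (- h).
rewrite -[RHS](preserves_Rintegral pt ih); apply: eq_Rintegral => r _.
rewrite slide_slide opprD opprK; congr (_ * _).
rewrite !indicE; congr ((nat_of_bool _)%:R).
by apply/idP/idP; rewrite !inE/= !in_itv/= !andbT ltrDr.
Qed.

(** The difference is an average of v, so 2 k v <= k^2 + v^2 integrated over the
    segment gives the bound without any limit; the two choices of k made below are
    the difference quotient itself and a weight times u. *)
Lemma difference_dual k : sqint mu k ->
  2 * \int[mu]_x (k x * (u (slide j h x) - u x)) <=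
  h * (\int[mu]_x k x ^+ 2 + \int[mu]_x v x ^+ 2).
Proof.
move=> hk; have hv : sqint mu v by exact: sqint_half.
have huh : sqint mu (u \o slide j h) by apply: sqint_preserves => //; exact: preserves_slide.
pose K1 (z : V * measurableTypeR R) := k z.1 ^+ 2 * \1_A z.2.
pose K2 (z : V * measurableTypeR R) := v z.1 ^+ 2 * \1_A z.2.
have i1 : intble mul K1 by exact: (intble_tensor_prod hk.2 iA).
have i2 : intble mul K2 by exact: (intble_tensor_prod hv.2 iA).
have ps := @preserves_skew R d j.
have i2s := preserves_integrable ps i2.
have i12 := intbleD i1 i2s.
have -> : h * (\int[mu]_x k x ^+ 2 + \int[mu]_x v x ^+ 2) =
    \int[mu]_x \int[leb]_r (K1 \+ (K2 \o skew j)) (x, r).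
  rewrite (Rintegral_fubini i12) RintegralD// (preserves_Rintegral ps i2).
  rewrite (Rintegral_tensor_prod hk.2 iA) (Rintegral_tensor_prod hv.2 iA) IA.
  by rewrite -mulrDl mulrC.
rewrite -RintegralZl//; last by apply: (sqintM hk); exact: sqintB.
apply: le_ae_Rintegral.
- by apply: intbleZ; apply: (sqintM hk); exact: sqintB.
- exact: intble_Rintegral2 i12.
have := ae_integrable1 i12; apply: filterS2 difference_identity => x [ix ->] ix2.
rewrite -RintegralZl// -RintegralZl//; last exact: intbleZ.
apply: le_Rintegral => //; first by do 2 apply: intbleZ.
move=> r _; rewrite /= /K1 /K2 /= indicE; case: (_ \in _); last by rewrite !mulr0 addr0.
rewrite !mulr1; have := sqr_ge0 (k x - v (slide j (- r) x)); nra.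
Qed.

Lemma difference_norm :
  \int[mu]_x (u (slide j h x) - u x) ^+ 2 <= h ^+ 2 * \int[mu]_x v x ^+ 2.
Proof.
have huh : sqint mu (u \o slide j h) by apply: sqint_preserves => //; exact: preserves_slide.
have hD : sqint mu (fun x => u (slide j h x) - u x) by exact: sqintB.
have := difference_dual (sqintZ h^-1 hD).
have -> : \int[mu]_x (h^-1 * (u (slide j h x) - u x) * (u (slide j h x) - u x)) =
  h^-1 * \int[mu]_x (u (slide j h x) - u x) ^+ 2.
  by rewrite -RintegralZl//; [apply: eq_Rintegral => x _; rewrite -mulrA -expr2|case: hD].
have -> : \int[mu]_x (h^-1 * (u (slide j h x) - u x)) ^+ 2 =
  h^-2 * \int[mu]_x (u (slide j h x) - u x) ^+ 2.
  by rewrite -RintegralZl//; [apply: eq_Rintegral => x _; rewrite exprMn exprVn|case: hD].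
set D := \int[mu]_x _; set G := \int[mu]_x _ => H.
have hn : h != 0 by rewrite gt_eqF.
have : h * (2 * (h^-1 * D)) <= h * (h * (h^-2 * D + G)) by rewrite ler_wpM2l// ltW.
have -> : h * (2 * (h^-1 * D)) = 2 * D by field.
have -> : h * (h * (h^-2 * D + G)) = D + h ^+ 2 * G by field.
lra.
Qed.

End difference.

(** * The odd oscillator inequality on a half-space *)

Section half_oscillator.
Context {R : realType} {d : nat}.
Local Notation V := 'rV[R]_d.
Local Notation mu := (@lebesgue_rV R d).
Variables (j : 'I_d) (f g : V -> R).
Let u := half j f.
Let v := half j g.
Let su (x : V) := x ord0 j * u x.
Hypotheses (hf : sqint mu f) (hg : sqint mu g) (hsu : sqint mu su).
Hypothesis uv : {ae mu, forall x, u x = ray j v x}.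
Variable t : R.
Hypothesis t0 : 0 <= t.

Let hu : sqint mu u. Proof. exact: sqint_half. Qed.
Let hv : sqint mu v. Proof. exact: sqint_half. Qed.

Let N := \int[mu]_x u x ^+ 2.
Let S := \int[mu]_x su x ^+ 2.
Let G := \int[mu]_x v x ^+ 2.

(** On the half-space this is 1/(s + a).  Truncating s at 0 makes it a bounded
    continuous function on the line without changing q(x_j) u. *)
Let q (a s : R) := (Num.max s 0 + a)^-1.

Let q_gt0 a s : 0 < a -> 0 < q a s.
Proof. by move=> a0; rewrite invr_gt0 ltr_wpDl// le_max lexx orbT. Qed.

Let q_le a s : 0 < a -> q a s <= a^-1.
Proof.
by move=> a0; rewrite lef_pV2 ?posrE// ?lerDr ?ltr_wpDl// le_max lexx orbT.
Qed.

Let measurable_q a : 0 < a -> measurable_fun setT (q a).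
Proof.
move=> a0; apply: continuous_measurable_fun => s.
apply: cvgV; first by rewrite gt_eqF// ltr_wpDl// le_max lexx orbT.
apply: cvgD; last exact: cvg_cst.
by apply: continuous_max; [exact: cvg_id|exact: cvg_cst].
Qed.

Let qu a (x : V) := u x * q a (x ord0 j).

Let sqint_qu a : 0 < a -> sqint mu (qu a).
Proof.
move=> a0; apply: (sqint_bounded (C := a^-1)) => //.
  by apply: measurableT_comp; [exact: measurable_q|exact: measurable_coord].
by move=> x; rewrite gtr0_norm ?q_gt0 ?q_le.
Qed.

(** The ground state of the odd oscillator is s exp(-t s^2/2), with logarithmic
    derivative 1/s - t s.  Expanding a square in which this weight is regularised
    to w(s) = 1/(s + a) - t s leaves w^2 + w', in which the singular terms cancel
    exactly.  Here the derivative is replaced by a difference quotient of step h,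
    and k is the mean of w u at the two endpoints: then 2 k (u_h - u) is an exact
    difference of w u^2 up to (w_h - w) u u_h, so the discrete integration by parts
    only uses translation invariance. *)
Let approx_h a h : 0 < a -> 0 < h ->
  t * N + 2 * t * \int[mu]_x (qu a x * su x) <=
  t ^+ 2 * S + G + h * (N / a ^+ 3 + (a ^- 2 + t) * (N + G) / 2).
Proof.
move=> a0 h0; have ps := @preserves_slide R d j h.
have hqu := sqint_qu a0.
pose W x := qu a x - t * su x.
have hW : sqint mu W by apply: sqintB => //; exact: sqintZ.
pose k x := 2^-1 * (W x + W (slide j h x)).
have hWh : sqint mu (W \o slide j h) by exact: sqint_preserves.
have hk : sqint mu k by apply: sqintZ; exact: sqintD.
have huh : sqint mu (u \o slide j h) by exact: sqint_preserves.
pose D x := u (slide j h x) - u x.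
have hD : sqint mu D by exact: sqintB.
have dual := difference_dual hu hg uv h0 hk.
have norm := difference_norm hu hg uv h0.
have iWu : intble mu (fun x => W x * u x) by exact: (sqintM hW hu).
have iWuh := preserves_integrable ps iWu.
have iu2 : intble mu (fun x => u x ^+ 2) by case: hu.
have iD2 : intble mu (fun x => D x ^+ 2) by case: hD.
have iqu2 : intble mu (fun x => qu a x ^+ 2) by case: hqu.
have ikD : intble mu (fun x => k x * D x) by exact: (sqintM hk hD).
have c20 : 0 <= (a ^- 2 + t) / 2 by rewrite divr_ge0// addr_ge0// invr_ge0 sqr_ge0.
(* The term h ^ 2 / a ^ 3 is the error made in the weight; the other terms come
   from u u_h = u ^ 2 + u (u_h - u) by the arithmetic-geometric mean inequality. *)
pose c1 := h ^+ 2 / a ^+ 3 + (a ^- 2 + t) * h ^+ 2 / 2.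
pose c2 := (a ^- 2 + t) / 2.
have pw x : h * (qu a x ^+ 2 + t * u x ^+ 2) <=
   2 * (k x * D x) - (W (slide j h x) * u (slide j h x) - W x * u x) +
   (c1 * u x ^+ 2 + c2 * D x ^+ 2).
  rewrite /k /D /W /qu /su; have [s0|s0] := ltP 0 (x ord0 j); last first.
    have -> : u x = 0 by rewrite /u /half ltNge s0 mulr0.
    set y := slide j h x; have : 0 <= c2 * u y ^+ 2 by rewrite mulr_ge0 ?sqr_ge0. 
    move: (u y) (q _ _) (q _ _) => U p p'; rewrite -subr_ge0 => z0.
    by rewrite (_ : _ - _ = c2 * U ^+ 2) //; field.
  rewrite slide_coord eqxx; set s := x ord0 j in s0 *; set U := u x; set U' := u _.
  have sa : 0 < s + a by rewrite addr_gt0.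
  have sha : 0 < s + h + a by rewrite !addr_gt0.
  have qE : q a s = (s + a)^-1 by rewrite /q max_l// ltW.
  have qE' : q a (s + h) = (s + h + a)^-1 by rewrite /q max_l// ltW// addr_gt0.
  have qq : q a s - q a (s + h) = h * (q a s * q a (s + h)).
    by rewrite qE qE'; field; rewrite !gt_eqF.
  have := q_le s a0; have := q_le (s + h) a0; have := q_gt0 s a0; have := q_gt0 (s + h) a0.
  move: qq; set p := q a s; set p' := q a (s + h); set b := a^-1 => qq p'0 p0 p'b pb.
  have b0 : 0 < b by rewrite invr_gt0.
  rewrite /c1 /c2 -!exprVn -/b.
  have ppb : p * p' <= b ^+ 2 by rewrite expr2 ler_pM// ltW.
  have pppb : p * (p * p') <= b ^+ 3 by rewrite exprS ler_pM// ltW// mulr_gt0.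
  have e2 : h * (b ^+ 2 + t) * (`|U| * `|U' - U|) <=
      (b ^+ 2 + t) / 2 * (h ^+ 2 * U ^+ 2 + (U' - U) ^+ 2).
    rewrite -(real_normK (num_real U)) -(real_normK (num_real (U' - U))).
    rewrite -subr_ge0 (_ : _ - _ = (b ^+ 2 + t) / 2 * (h * `|U| - `|U' - U|) ^+ 2); last by field.
    by rewrite mulr_ge0 ?sqr_ge0// divr_ge0// addr_ge0// sqr_ge0.
  have e3 : h ^+ 2 * (p * (p * p')) * U ^+ 2 <= h ^+ 2 * b ^+ 3 * U ^+ 2.
    by rewrite ler_wpM2r ?sqr_ge0// ler_wpM2l// sqr_ge0.
  (* By qq, the difference of the weights is p - p' = h p p'; it replaces one
     factor p by p' on the left and appears as (p - p' + t h) U U' on the right. *)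
  have -> : h * ((U * p) ^+ 2 + t * U ^+ 2) =
     h * (p * p' + t) * U ^+ 2 + h ^+ 2 * (p * (p * p')) * U ^+ 2.
    have -> : h ^+ 2 * (p * (p * p')) = h * p * (h * (p * p')) by ring.
    by rewrite -qq; ring.
  set rhs := (X in _ <= X).
  have -> : rhs = h * (p * p' + t) * U ^+ 2 + h * (p * p' + t) * (U * (U' - U)) +
      h ^+ 2 * b ^+ 3 * U ^+ 2 + (b ^+ 2 + t) / 2 * (h ^+ 2 * U ^+ 2 + (U' - U) ^+ 2).
    rewrite /rhs.
    have -> : h * (p * p' + t) * U ^+ 2 + h * (p * p' + t) * (U * (U' - U)) =
       (h * (p * p') + h * t) * (U * U') by ring.
    by rewrite -qq; field.
  have e1' : - (h * (p * p' + t) * (U * (U' - U))) <= h * (b ^+ 2 + t) * (`|U| * `|U' - U|).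
    apply: le_trans (ler_norm _) _; rewrite normrN !normrM.
    rewrite (gtr0_norm h0) (ger0_norm (x := p * p' + t)); last first.
      by rewrite addr_ge0// mulr_ge0// ltW.
    by rewrite ler_wpM2r ?mulr_ge0// ler_wpM2l ?lerD2r// ltW.
  lra.
have I1 : h * (\int[mu]_x qu a x ^+ 2 + t * N) <=
   2 * \int[mu]_x (k x * D x) + (c1 * N + c2 * \int[mu]_x D x ^+ 2).
  have il : intble mu (fun x => qu a x ^+ 2 + t * u x ^+ 2).
    by apply: intbleD => //; exact: intbleZ.
  have ir1 : intble mu (fun x => 2 * (k x * D x) -
      (W (slide j h x) * u (slide j h x) - W x * u x)).
    by apply: intbleB; [exact: intbleZ|exact: intbleB].
  have ir2 : intble mu (fun x => c1 * u x ^+ 2 + c2 * D x ^+ 2).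
    by apply: intbleD; exact: intbleZ.
  have := le_Rintegral measurableT (intbleZ h il) (intbleD ir1 ir2) (fun x _ => pw x).
  rewrite RintegralZl// RintegralD//; last exact: intbleZ.
  rewrite RintegralZl// RintegralD// RintegralB//; last 2 first.
  - exact: intbleZ.
  - exact: intbleB.
  rewrite RintegralB// (preserves_Rintegral ps iWu) subrr subr0.
  by rewrite RintegralD ?RintegralZl//; exact: intbleZ.
have I2 : \int[mu]_x k x ^+ 2 <= \int[mu]_x qu a x ^+ 2
    - 2 * t * \int[mu]_x (qu a x * su x) + t ^+ 2 * S.
  have iW2 : intble mu (fun x => W x ^+ 2) by case: hW.
  have iWh2 := preserves_integrable ps iW2.
  have iqs : intble mu (fun x => qu a x * su x) by exact: (sqintM hqu hsu).
  have is2 : intble mu (fun x => su x ^+ 2) by case: hsu.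
  have -> : \int[mu]_x qu a x ^+ 2 - 2 * t * \int[mu]_x (qu a x * su x) + t ^+ 2 * S
      = \int[mu]_x W x ^+ 2.
    rewrite -RintegralZl// -RintegralB//; last exact: intbleZ.
    rewrite -RintegralZl// -RintegralD//; last 2 first.
    - by apply: intbleB => //; exact: intbleZ.
    - exact: intbleZ.
    by apply: eq_Rintegral => x _; rewrite /W; ring.
  apply: (@le_trans _ _ (\int[mu]_x (2^-1 * (W x ^+ 2 + W (slide j h x) ^+ 2)))).
    apply: le_Rintegral => //; [by case: hk|by apply: intbleZ; exact: intbleD|].
    move=> x _; rewrite /k; move: (W x) (W (slide j h x)) => A B.
    rewrite -subr_ge0 (_ : _ - _ = (2^-1 * (A - B)) ^+ 2) ?sqr_ge0//; by field.
  rewrite RintegralZl//; last exact: intbleD.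
  by rewrite RintegralD// (preserves_Rintegral ps iW2); lra.
set Q2 := \int[mu]_x qu a x ^+ 2 in I1 I2; set QS := \int[mu]_x (qu a x * su x) in I2 *.
set K := \int[mu]_x k x ^+ 2 in I2 dual.
rewrite -/D in dual norm; rewrite -/G in dual norm.
set KD := \int[mu]_x (k x * D x) in I1 dual.
set D2 := \int[mu]_x D x ^+ 2 in I1 norm.
have : c2 * D2 <= c2 * (h ^+ 2 * G) by rewrite ler_wpM2l.
move=> J; have : h * (Q2 + t * N) <= h * (K + G) + (c1 * N + c2 * (h ^+ 2 * G)) by lra.
have -> : h * (K + G) + (c1 * N + c2 * (h ^+ 2 * G)) =
   h * (K + G + h * (N / a ^+ 3 + (a ^- 2 + t) * (N + G) / 2)).
  rewrite /c1 /c2; field; exact: lt0r_neq0.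
rewrite ler_pM2l//; lra.
Qed.

Let approx a : 0 < a ->
  t * N + 2 * t * \int[mu]_x (qu a x * su x) <= t ^+ 2 * S + G.
Proof.
move=> a0; set c := N / a ^+ 3 + (a ^- 2 + t) * (N + G) / 2.
have H h (h0 : 0 < h) := approx_h a0 h0.
apply/ler_addgt0Pr => e e0.
have c1 : 0 < `|c| + 1 by rewrite ltr_wpDl.
apply: le_trans (H (e / (`|c| + 1)) (divr_gt0 e0 c1)) _; rewrite -/c.
rewrite lerD2l -mulrA ger_pMr// ler_pdivrMl// mulr1.
by rewrite (le_trans (ler_norm _))// lerDl.
Qed.

(** As a tends to 0, s/(s + a) increases to 1 on the half-space, so the factor
    t + 2 t s/(s + a) tends to 3 t. *)
Lemma half_oscillator_ge : 3 * t * N <= G + t ^+ 2 * S.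
Proof.
pose X n := \int[mu]_x (qu n.+1%:R^-1 x * su x).
suff XN : X n @[n --> \oo] --> N.
  have cl : (t * N + 2 * t * X n) @[n --> \oo] --> t * N + 2 * t * N.
    by apply: cvgD; [exact: cvg_cst|apply: cvgM => //; exact: cvg_cst].
  have -> : 3 * t * N = t * N + 2 * t * N by ring.
  rewrite [leRHS]addrC; apply: (cvgr_to_le cl); apply: nearW => n; apply: approx.
  by rewrite invr_gt0.
have iu2 : intble mu (fun x => u x ^+ 2) by case: hu.
have a0 n : 0 < n.+1%:R^-1 :> R by rewrite invr_gt0.
have iX n : intble mu (fun x => qu n.+1%:R^-1 x * su x) by exact: (sqintM (sqint_qu (a0 n)) hsu).
have XE n x : qu n.+1%:R^-1 x * su x = u x ^+ 2 * (x ord0 j / (x ord0 j + n.+1%:R^-1)).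
  rewrite /qu /su /q; have [s0|s0] := ltP 0 (x ord0 j); first by rewrite ?max_l ?ltW//; ring.
  have -> : u x = 0 by rewrite /u /half ltNge s0 mulr0.
  by rewrite expr0n !mul0r.
have := @dominated_convergence _ V R mu setT measurableT
  (fun n x => (qu n.+1%:R^-1 x * su x)%:E) (fun x => (u x ^+ 2)%:E)
  (fun x => (u x ^+ 2)%:E).
case.
- by move=> n; exact: measurable_int (iX n).
- exact: measurable_int iu2.
- apply: aeW => x _; apply: cvg_EFin; first exact: nearW.
  rewrite [X in X @ _ --> _](_ : _ = fun n => u x ^+ 2 * (x ord0 j / (x ord0 j + n.+1%:R^-1))).
    have [s0|s0] := ltP 0 (x ord0 j); last first.
      have -> : u x = 0 by rewrite /u /half ltNge s0 mulr0.
      rewrite expr0n; under eq_fun do rewrite mul0r.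
      exact: cvg_cst.
    rewrite -[X in _ --> X]mulr1; apply: cvgM; first exact: cvg_cst.
    rewrite -[X in _ --> X](@mulfV _ (x ord0 j)) ?gt_eqF//; apply: cvgM; first exact: cvg_cst.
    apply: cvgV; first by rewrite gt_eqF.
    rewrite -[X in _ --> X]addr0; apply: cvgD; first exact: cvg_cst.
    exact: (@cvg_harmonic R).
  by apply/funext => n; exact: XE.
- exact: iu2.
- apply: aeW => x n _; rewrite lee_fin XE.
  have [s0|s0] := ltP 0 (x ord0 j); last first.
    have -> : u x = 0 by rewrite /u /half ltNge s0 mulr0.
    by rewrite expr0n mul0r normr0.
  have sa : 0 < x ord0 j + n.+1%:R^-1 by rewrite addr_gt0.
  rewrite ger0_norm; last by rewrite mulr_ge0 ?sqr_ge0// divr_ge0 ?ltW.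
  by rewrite ler_piMr ?sqr_ge0// ler_pdivrMr// mul1r lerDl ltW.
have -> : (\int[mu]_x (u x ^+ 2)%:E = N%:E)%E.
  by rewrite fineK//; exact: integrable_fin_num iu2.
by move=> _ _ /fine_cvgP[].
Qed.

End half_oscillator.

(** * Parity and orthogonality *)

Section odd_oscillator.
Context {R : realType} {d : nat}.
Local Notation V := 'rV[R]_d.
Local Notation mu := (@lebesgue_rV R d).
Implicit Types (f g : V -> R).

(** For an odd function the ground state energy 1 of the oscillator is replaced by
    3, the energy of the first excited state. *)
Lemma odd_oscillator_ge j f g (t : R) : 0 <= t ->
  sqint mu f -> sqint mu g -> sqint mu (fun x => x ord0 j * f x) -> is_weak_partial_real j f g ->
  {ae mu, forall x, f (flip_coord j x) = - f x} ->
  {ae mu, forall x, g (flip_coord j x) = g x} ->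
  3 * t * \int[mu]_x f x ^+ 2 <=
  \int[mu]_x g x ^+ 2 + t ^+ 2 * \int[mu]_x (x ord0 j * f x) ^+ 2.
Proof.
move=> t0 hf hg hs w fodd geven.
have E (h : V -> R) : sqint mu h ->
    {ae mu, forall x, h (flip_coord j x) ^+ 2 = h x ^+ 2} ->
    \int[mu]_x h x ^+ 2 = 2 * \int[mu]_x half j h x ^+ 2.
  move=> hh he; rewrite (Rintegral_even hh.2 he); congr (_ * _).
  apply: eq_Rintegral => x _; rewrite /half; case: (0 < _).
    by rewrite !mulr1.
  by rewrite !mulr0 expr0n.
have hsu : sqint mu (fun x => x ord0 j * half j f x).
  rewrite (_ : (fun _ => _) = half j (fun x => x ord0 j * f x)); first exact: sqint_half.
  by apply/funext => x; rewrite /half mulrA.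
have := half_oscillator_ge hf hg hsu (ray_identity hf hg w fodd geven) t0.
rewrite (E f)//; last by apply: filterS fodd => x ->; rewrite sqrrN.
rewrite (E g)//; last by apply: filterS geven => x ->.
rewrite (E (fun x => x ord0 j * f x))//; last first.
  by apply: filterS fodd => x ->; rewrite flip_coordE eqxx mulrNN.
rewrite (_ : \int[mu]_x half j (fun x => x ord0 j * f x) x ^+ 2 =
  \int[mu]_x (x ord0 j * half j f x) ^+ 2); first by lra.
by apply: eq_Rintegral => x _; rewrite /half mulrA.
Qed.

Lemma Rintegral_odd k f : intble mu f ->
  {ae mu, forall x, f (flip_coord k x) = - f x} -> \int[mu]_x f x = 0.
Proof.
move=> hf fodd; have pk := @preserves_flip R d k.
suff : \int[mu]_x f x = - \int[mu]_x f x by lra.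
rewrite -{1}(preserves_Rintegral pk hf) -mulN1r -RintegralZl//; apply: ae_Rintegral.
- exact: intble_measurable (preserves_integrable pk hf).
- by apply: measurable_funM => //; exact: intble_measurable hf.
- by apply: filterS fodd => x ->; rewrite mulN1r.
Qed.

Lemma intble_sum (I : Type) (r : seq I) (w : I -> V -> R) : (forall i, intble mu (w i)) ->
  intble mu (fun x => \sum_(i <- r) w i x).
Proof.
move=> iw; elim: r => [|i r IH].
  under eq_fun do rewrite big_nil.
  exact: integrable0.
under eq_fun do rewrite big_cons.
exact: intbleD.
Qed.

Lemma Rintegral_sum (I : Type) (r : seq I) (w : I -> V -> R) : (forall i, intble mu (w i)) ->
  \int[mu]_x (\sum_(i <- r) w i x) = \sum_(i <- r) \int[mu]_x w i x.
Proof.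
move=> iw; elim: r => [|i r IH].
  rewrite big_nil; under eq_Rintegral do rewrite big_nil.
  by rewrite Rintegral_cst// mul0r.
rewrite big_cons -IH -RintegralD//; last exact: intble_sum.
by apply: eq_Rintegral => x _; rewrite big_cons.
Qed.

Variable c : 'I_d -> R.

Lemma sqint_lincomb (w : 'I_d -> V -> R) : (forall i, sqint mu (w i)) ->
  sqint mu (fun x => \sum_i c i * w i x).
Proof.
move=> hw; elim: (index_enum _) => [|i r IH].
  under eq_fun do rewrite big_nil.
  split => //; under eq_fun do rewrite expr0n; exact: integrable0.
under eq_fun do rewrite big_cons.
by apply: sqintD => //; exact: sqintZ.
Qed.

Lemma Rintegral_lincomb0 (w : 'I_d -> V -> R) h : (forall i, sqint mu (w i)) -> sqint mu h ->
  (forall i, \int[mu]_x (w i x * h x) = 0) ->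
  \int[mu]_x ((\sum_i c i * w i x) * h x) = 0.
Proof.
move=> hw hh w0; under eq_Rintegral do rewrite mulr_suml.
rewrite Rintegral_sum; last first.
  by move=> i; apply: (sqintM (sqintZ (c i) (hw i)) hh).
apply: big1 => i _; under eq_Rintegral do rewrite -mulrA.
by rewrite RintegralZl ?w0 ?mulr0//; exact: (sqintM (hw i) hh).
Qed.

Lemma Rintegral_orthogonal (w : 'I_d -> V -> R) : (forall i, sqint mu (w i)) ->
  (forall i k, i != k -> \int[mu]_x (w i x * w k x) = 0) ->
  \int[mu]_x (\sum_i c i * w i x) ^+ 2 = \sum_i c i ^+ 2 * \int[mu]_x w i x ^+ 2.
Proof.
move=> hw w0; have hs := sqint_lincomb hw.
under eq_Rintegral do rewrite expr2 mulr_suml.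
rewrite Rintegral_sum; last by move=> i; apply: (sqintM (sqintZ (c i) (hw i)) hs).
apply: eq_bigr => i _.
have E x : c i * w i x * (\sum_k c k * w k x) = \sum_k c i * c k * (w i x * w k x).
  by rewrite mulr_sumr; apply: eq_bigr => k _; ring.
under eq_Rintegral do rewrite E.
have iww k : intble mu (fun x => w i x * w k x) by exact: (sqintM (hw i) (hw k)).
rewrite Rintegral_sum; last by move=> k; exact: intbleZ.
rewrite (bigD1 i)//= big1 ?addr0; last first.
  by move=> k ki; rewrite RintegralZl// w0 ?mulr0// eq_sym.
rewrite RintegralZl// -expr2; congr (_ * _).
Qed.

End odd_oscillator.

(** The inequality is used at the minimiser t = 3 c / (2 A); if A = 0 its
    left-hand side is unbounded in t. *)
Lemma quadratic_discriminant (R : realType) (A B c : R) : 0 <= A -> 0 < c ->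
  (forall t, 0 <= t -> 3 * t * c <= B + t ^+ 2 * A) -> 9 / 4 * c ^+ 2 <= A * B.
Proof.
move=> A0 c0 H; have [A1|A1] := eqVneq A 0.
  have B0 := H 0 (lexx _); rewrite mulr0 mul0r expr0n mul0r addr0 in B0.
  have B1 : 0 < B + 1 by rewrite ltr_wpDl.
  have := H ((B + 1) / c) (ltW (divr_gt0 B1 c0)).
  rewrite A1 mulr0 addr0 -mulrA mulfVK ?gt_eqF//; lra.
have Ap : 0 < A by rewrite lt0r A1.
have tt : 0 <= 3 * c / (2 * A) by apply: divr_ge0; apply: mulr_ge0 => //; exact: ltW.
have := H _ tt; rewrite -(ler_pM2l Ap) => h.
have e1 : A * (3 * (3 * c / (2 * A)) * c) = 9 / 2 * c ^+ 2 by field.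
have e2 : A * (B + (3 * c / (2 * A)) ^+ 2 * A) = A * B + 9 / 4 * c ^+ 2 by field.
by move: h; rewrite e1 e2; lra.
Qed.

Import ComplexField.Normc.

(** * Real and imaginary parts *)

Section complex_parts.
Context {R : realType} {d : nat}.
Local Notation V := 'rV[R]_d.
Local Notation C := R[i].
Local Notation mu := (@lebesgue_rV R d).
Implicit Types (f g : V -> C).

Definition re_part f (x : V) : R := complex.Re (f x).
Definition im_part f (x : V) : R := complex.Im (f x).

Lemma normc_sqr (z : C) : normc z ^+ 2 = complex.Re z ^+ 2 + complex.Im z ^+ 2.
Proof. by case: z => a b; rewrite /normc sqr_sqrtr// addr_ge0 ?sqr_ge0. Qed.

Lemma sqint_parts f (c : V -> R) : cmeasurable f -> measurable_fun setT c ->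
  (\int[mu]_x (c x ^+ 2 * normc (f x) ^+ 2)%:E < +oo)%E ->
  sqint mu (fun x => c x * re_part f x) /\ sqint mu (fun x => c x * im_part f x).
Proof.
move=> [mre mim] mc foo.
have {}mre : measurable_fun setT (re_part f) by [].
have {}mim : measurable_fun setT (im_part f) by [].
have E x : c x ^+ 2 * normc (f x) ^+ 2 = c x ^+ 2 * (re_part f x ^+ 2 + im_part f x ^+ 2).
  by rewrite normc_sqr.
have i0 : intble mu (fun x => c x ^+ 2 * normc (f x) ^+ 2).
  apply/integrableP; split.
    apply/measurable_EFinP; under eq_fun do rewrite E.
    by apply: measurable_funM; last apply: measurable_funD; exact: measurable_funX.
  apply: le_lt_trans foo; rewrite le_eqVlt; apply/orP; left; apply/eqP.
  by apply: eq_integral => x _; rewrite /= ger0_norm// mulr_ge0 ?sqr_ge0.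
split; (split; first exact: measurable_funM).
- apply: (le_intble _ _ i0); first by apply: measurable_funX; exact: measurable_funM.
  move=> x; rewrite E normrX normrM exprMn !real_normK ?num_real//.
  by rewrite ler_wpM2l ?sqr_ge0// lerDl sqr_ge0.
- apply: (le_intble _ _ i0); first by apply: measurable_funX; exact: measurable_funM.
  move=> x; rewrite E normrX normrM exprMn !real_normK ?num_real//.
  by rewrite ler_wpM2l ?sqr_ge0// lerDr sqr_ge0.
Qed.

Lemma inL2_parts f : inL2 f -> sqint mu (re_part f) /\ sqint mu (im_part f).
Proof.
move=> [mf foo].
have := @sqint_parts f (cst 1) mf (measurable_cst _).
rewrite (_ : (fun x : V => cst 1 x * re_part f x) = re_part f); last first.
  by apply/funext => x; rewrite mul1r.
rewrite (_ : (fun x : V => cst 1 x * im_part f x) = im_part f); last first.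
  by apply/funext => x; rewrite mul1r.
apply; under eq_integral do rewrite /= expr1n mul1r.
exact: foo.
Qed.

Lemma dotv_ge0 (x : V) : 0 <= dotv x x.
Proof. by apply: sumr_ge0 => i _; rewrite -expr2 sqr_ge0. Qed.

Lemma enorm_sqr (x : V) : enorm x ^+ 2 = dotv x x.
Proof. by rewrite sqr_sqrtr// dotv_ge0. Qed.

Lemma dotv_gt0 (x : V) : x != 0 -> 0 < dotv x x.
Proof.
move=> x0; rewrite lt0r dotv_ge0 andbT; apply: contra_neq x0 => /eqP.
rewrite psumr_eq0; last by move=> i _; rewrite -expr2 sqr_ge0.
move=> /allP h; apply/rowP => i; rewrite mxE.
by have := h i (mem_index_enum i); rewrite /= mulf_eq0 orbb => /eqP.
Qed.

Lemma domA_parts f j : domA f ->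
  sqint mu (fun x => x ord0 j * re_part f x) /\ sqint mu (fun x => x ord0 j * im_part f x).
Proof.
move=> [[mf _] foo]; apply: sqint_parts => //; first exact: measurable_coord.
have [mre mim] := mf.
have mn : measurable_fun setT (fun x => normc (f x) ^+ 2).
  under eq_fun do rewrite normc_sqr.
  by apply: measurable_funD; exact: measurable_funX.
apply: le_lt_trans foo; apply: ge0_le_integral => //.
- by move=> x _; rewrite lee_fin mulr_ge0 ?sqr_ge0.
- apply/measurable_EFinP; apply: measurable_funM => //.
  by apply: measurable_funX; exact: measurable_coord.
- apply/measurable_EFinP; apply: measurable_funM => //.
  under eq_fun do rewrite enorm_sqr.
  apply: measurable_sum => i; apply: measurable_funM; exact: measurable_coord.
- move=> x _; rewrite lee_fin ler_wpM2r ?sqr_ge0// enorm_sqr /dotv (bigD1 j)//= -expr2 lerDl.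
  by apply: sumr_ge0 => i _; rewrite -expr2 sqr_ge0.
Qed.

Lemma is_weak_partial_real_parts j f g : is_weak_partial j f g ->
  is_weak_partial_real j (re_part f) (re_part g) /\ is_weak_partial_real j (im_part f) (im_part g).
Proof.
have E (z : C) (r : R) : (complex.Re (z * real_complex R r) = complex.Re z * r) *
   (complex.Im (z * real_complex R r) = complex.Im z * r).
  by case: z => a b /=; rewrite !mulr0 subr0 add0r.
move=> w; split=> phi tphi.
- have : \int[mu]_x complex.Re (f x * real_complex R ('D_(unitv j) phi x)) =
      - \int[mu]_x complex.Re (g x * real_complex R (phi x)).
    exact: (congr1 (@complex.Re R) (w phi tphi)).
  under eq_Rintegral do rewrite E; move=> ->.
  by under eq_Rintegral do rewrite E.
- have : \int[mu]_x complex.Im (f x * real_complex R ('D_(unitv j) phi x)) =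
      - \int[mu]_x complex.Im (g x * real_complex R (phi x)).
    exact: (congr1 (@complex.Im R) (w phi tphi)).
  under eq_Rintegral do rewrite E; move=> ->.
  by under eq_Rintegral do rewrite E.
Qed.

Lemma weak_partialP j f : domB f -> L2_weak_partial j f (weak_partial j f).
Proof. by move=> [_ /(_ j)]; exact: xgetPex. Qed.

Lemma L2norm_sqr f : L2norm f ^+ 2 = \int[mu]_x (re_part f x ^+ 2 + im_part f x ^+ 2).
Proof.
rewrite sqr_sqrtr; last by apply: Rintegral_ge0 => x _; rewrite sqr_ge0.
by apply: eq_Rintegral => x _; rewrite normc_sqr.
Qed.


Lemma parts_sum (c : 'I_d -> R) (w : 'I_d -> V -> C) x :
  (complex.Re (\sum_j real_complex R (c j) * w j x) = \sum_j c j * re_part (w j) x) *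
  (complex.Im (\sum_j real_complex R (c j) * w j x) = \sum_j c j * im_part (w j) x).
Proof.
rewrite !raddf_sum; split; apply: eq_bigr => j _; rewrite /re_part /im_part;
  by case: (w j x) => a b /=; rewrite ?mul0r ?subr0 ?addr0.
Qed.

End complex_parts.

(** * The two variances *)

Section uncertainty_odd.
Context {R : realType} {d : nat}.
Local Notation V := 'rV[R]_d.
Local Notation mu := (@lebesgue_rV R d).
Variables (L : V) (f : V -> R[i]).
Hypotheses (fA : domA f) (fB : domB f).
Hypothesis f_odd : forall k : 'I_d, {ae mu, forall x, f x = - f (flip_coord k x)}.

Let u := re_part f.
Let v := im_part f.
Let p j := re_part (weak_partial j f).
Let q j := im_part (weak_partial j f).
Let c j := L ord0 j.

Let hu : sqint mu u. Proof. by case: (inL2_parts fA.1). Qed.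
Let hv : sqint mu v. Proof. by case: (inL2_parts fA.1). Qed.
Let hxu j : sqint mu (fun x => x ord0 j * u x).
Proof. by case: (domA_parts j fA). Qed.
Let hxv j : sqint mu (fun x => x ord0 j * v x).
Proof. by case: (domA_parts j fA). Qed.
Let hp j : sqint mu (p j).
Proof. by have [h _] := weak_partialP j fB; case: (inL2_parts h). Qed.
Let hq j : sqint mu (q j).
Proof. by have [h _] := weak_partialP j fB; case: (inL2_parts h). Qed.
Let wp j : is_weak_partial_real j u (p j).
Proof. by have [_ h] := weak_partialP j fB; case: (is_weak_partial_real_parts h). Qed.
Let wq j : is_weak_partial_real j v (q j).
Proof. by have [_ h] := weak_partialP j fB; case: (is_weak_partial_real_parts h). Qed.

Let u_odd k : {ae mu, forall x, u (flip_coord k x) = - u x}.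
Proof.
by apply: filterS (f_odd k) => x; rewrite /u /re_part => ->; rewrite raddfN opprK.
Qed.
Let v_odd k : {ae mu, forall x, v (flip_coord k x) = - v x}.
Proof.
by apply: filterS (f_odd k) => x; rewrite /v /im_part => ->; rewrite raddfN opprK.
Qed.

Let p_parity j k : {ae mu, forall x, p j (flip_coord k x) = if k == j then p j x else - p j x}.
Proof. exact: weak_partial_parity hu (hp j) (wp j) (u_odd k). Qed.
Let q_parity j k : {ae mu, forall x, q j (flip_coord k x) = if k == j then q j x else - q j x}.
Proof. exact: weak_partial_parity hv (hq j) (wq j) (v_odd k). Qed.

(** The statements below are applied to the real and to the imaginary part of f and
    of its weak derivatives. *)
Section one_part.
Variables (h : V -> R) (r : 'I_d -> V -> R).
Hypotheses (hh : sqint mu h) (hr : forall j, sqint mu (r j)).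
Hypothesis hxh : forall j, sqint mu (fun x => x ord0 j * h x).
Hypothesis h_odd : forall k, {ae mu, forall x, h (flip_coord k x) = - h x}.
Hypothesis r_parity : forall j k,
  {ae mu, forall x, r j (flip_coord k x) = if k == j then r j x else - r j x}.

Lemma moment_orthogonal : \int[mu]_x (dotv L x * h x) ^+ 2 =
  \sum_i c i ^+ 2 * \int[mu]_x (x ord0 i * h x) ^+ 2.
Proof.
rewrite -Rintegral_orthogonal//.
  by apply: eq_Rintegral => x _; rewrite /dotv mulr_suml; congr (_ ^+ 2);
    apply: eq_bigr => i _; rewrite mulrA.
move=> i k ik; apply: (Rintegral_odd (k := i)); first exact: (sqintM (hxh i) (hxh k)).
apply: filterS (h_odd i) => x hx; rewrite hx !flip_coordE eqxx eq_sym (negbTE ik).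
ring.
Qed.

Lemma moment_mean : \int[mu]_x (dotv L x * h x ^+ 2) = 0.
Proof.
rewrite -[RHS](Rintegral_lincomb0 c (w := fun i x => x ord0 i * h x) hxh hh).
  apply: eq_Rintegral => x _; rewrite expr2 mulrA; congr (_ * _); rewrite /dotv mulr_suml.
  by apply: eq_bigr => i _; rewrite mulrA.
move=> i; apply: (Rintegral_odd (k := i)); first exact: (sqintM (hxh i) hh).
by apply: filterS (h_odd i) => x ->; rewrite flip_coordE eqxx; ring.
Qed.

Lemma derivative_orthogonal : \int[mu]_x (\sum_j c j * r j x) ^+ 2 =
  \sum_i c i ^+ 2 * \int[mu]_x r i x ^+ 2.
Proof.
apply: Rintegral_orthogonal => // i k ik.
apply: (Rintegral_odd (k := i)); first exact: (sqintM (hr i) (hr k)).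
apply: filterS2 (r_parity i i) (r_parity k i) => x; rewrite eqxx (negbTE ik) => -> ->.
by rewrite mulrN.
Qed.

End one_part.

Lemma derivative_mean (h : V -> R) (r : 'I_d -> V -> R) : sqint mu h ->
  (forall j, sqint mu (r j)) ->
  (forall k, {ae mu, forall x, h (flip_coord k x) = - h x}) ->
  (forall j, {ae mu, forall x, r j (flip_coord j x) = r j x}) ->
  \int[mu]_x ((\sum_j c j * r j x) * h x) = 0.
Proof.
move=> hh hr h_odd r_even; apply: Rintegral_lincomb0 => // i.
apply: (Rintegral_odd (k := i)); first exact: (sqintM (hr i) hh).
by apply: filterS2 (h_odd i) (r_even i) => x -> ->; rewrite mulrN.
Qed.


(** The number 2 pi is kept abstract: its square cancels in the product of the two
    variances. *)
Let cpi : R := 2 * pi.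
Let cpi0 : 0 < cpi. Proof. by rewrite mulr_gt0// pi_gt0. Qed.

Let A := \sum_i c i ^+ 2 * (\int[mu]_x (x ord0 i * u x) ^+ 2 + \int[mu]_x (x ord0 i * v x) ^+ 2).
Let B := \sum_i c i ^+ 2 * (\int[mu]_x p i x ^+ 2 + \int[mu]_x q i x ^+ 2).
Let N := \int[mu]_x u x ^+ 2 + \int[mu]_x v x ^+ 2.

Let L2normE g : sqint mu (re_part g) -> sqint mu (im_part g) ->
  L2norm g ^+ 2 = \int[mu]_x re_part g x ^+ 2 + \int[mu]_x im_part g x ^+ 2.
Proof. by move=> [_ h1] [_ h2]; rewrite L2norm_sqr RintegralD. Qed.

Let sqint_dotv h : (forall j, sqint mu (fun x => x ord0 j * h x)) ->
  sqint mu (fun x => dotv L x * h x).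
Proof.
move=> hxh; rewrite (_ : (fun _ => _) = fun x : V => \sum_i c i * (x ord0 i * h x)).
  exact: (sqint_lincomb c hxh).
by apply/funext => x; rewrite /dotv mulr_suml; apply: eq_bigr => i _; rewrite mulrA.
Qed.

(** The mean of A_L vanishes because |f|^2 is even in each coordinate while x_i is
    odd; for the same reason the mixed terms x_i x_k |f|^2 integrate to 0. *)
Lemma Delta_opA : Delta (opA L) f = cpi ^+ 2 * A.
Proof.
have reE : re_part (opA L f) = fun x => cpi * (dotv L x * u x).
  apply/funext => x; rewrite /re_part /opA /u /re_part /cpi.
  by case: (f x) => a b /=; rewrite mul0r subr0 mulrA.
have imE : im_part (opA L f) = fun x => cpi * (dotv L x * v x).
  apply/funext => x; rewrite /im_part /opA /v /im_part /cpi.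
  by case: (f x) => a b /=; rewrite mul0r addr0 mulrA.
have su := sqint_dotv hxu; have sv := sqint_dotv hxv.
have scale h : sqint mu h -> \int[mu]_x (cpi * h x) ^+ 2 = cpi ^+ 2 * \int[mu]_x h x ^+ 2.
  by move=> [_ hh]; rewrite -RintegralZl//; apply: eq_Rintegral => x _; rewrite exprMn.
rewrite /Delta.
have -> : L2inner (opA L f) f = 0.
  rewrite /L2inner /cintegral; congr Complex.
    transitivity (\int[mu]_x (cpi * (dotv L x * u x ^+ 2 + dotv L x * v x ^+ 2))).
      apply: eq_Rintegral => x _; rewrite /opA /u /v /re_part /im_part.
      by case: (f x) => a b /=; rewrite /cpi; ring.
    have iu : intble mu (fun x => dotv L x * u x ^+ 2).
      have := sqintM su hu; apply: eq_integrable => // x _.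
      by rewrite /= expr2 mulrA.
    have iv : intble mu (fun x => dotv L x * v x ^+ 2).
      have := sqintM sv hv; apply: eq_integrable => // x _.
      by rewrite /= expr2 mulrA.
    rewrite RintegralZl//; last exact: intbleD.
    by rewrite RintegralD// (moment_mean hu hxu u_odd) (moment_mean hv hxv v_odd) addr0 mulr0.
  transitivity (\int[mu]_x (cst 0 x : R)); last by rewrite Rintegral_cst// mul0r.
  apply: eq_Rintegral => x _; rewrite /opA.
  by case: (f x) => a b /=; ring.
rewrite normc0 expr0n mul0r subr0 L2normE; last 2 first.
- by rewrite reE; exact: sqintZ.
- by rewrite imE; exact: sqintZ.
rewrite reE imE (scale _ su) (scale _ sv) (moment_orthogonal hxu u_odd).
rewrite (moment_orthogonal hxv v_odd) -mulrDr -big_split/=; congr (_ * _).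
by apply: eq_bigr => i _; rewrite mulrDr.
Qed.

(** The i-th derivative is even in x_i while f and the k-th derivative, k <> i, are
    odd in it: the mean of B_L and the mixed terms vanish. *)
Lemma Delta_opB : Delta (opB L) f = cpi ^- 2 * B.
Proof.
pose P x := \sum_j c j * p j x; pose Q x := \sum_j c j * q j x.
have ddE x : (complex.Re (ddir L f x) = P x) * (complex.Im (ddir L f x) = Q x).
  split; first exact: (parts_sum c (fun j => weak_partial j f) x).1.
  exact: (parts_sum c (fun j => weak_partial j f) x).2.
have reE : re_part (opB L f) = fun x => - cpi^-1 * Q x.
  apply/funext => x; rewrite /re_part /opB -(ddE x).2 /cpi.
  by case: (ddir L f x) => a b /=; rewrite mul0r sub0r mulNr.
have imE : im_part (opB L f) = fun x => cpi^-1 * P x.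
  apply/funext => x; rewrite /im_part /opB -(ddE x).1 /cpi.
  by case: (ddir L f x) => a b /=; rewrite mul0r add0r.
have sP : sqint mu P by exact: sqint_lincomb.
have sQ : sqint mu Q by exact: sqint_lincomb.
have p_even j : {ae mu, forall x, p j (flip_coord j x) = p j x}.
  by apply: filterS (p_parity j j) => x; rewrite eqxx.
have q_even j : {ae mu, forall x, q j (flip_coord j x) = q j x}.
  by apply: filterS (q_parity j j) => x; rewrite eqxx.
have scale a h : sqint mu h -> \int[mu]_x (a * h x) ^+ 2 = a ^+ 2 * \int[mu]_x h x ^+ 2.
  by move=> [_ hh]; rewrite -RintegralZl//; apply: eq_Rintegral => x _; rewrite exprMn.
have Pu := derivative_mean hu hp u_odd p_even.
have Pv := derivative_mean hv hp v_odd p_even.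
have Qu := derivative_mean hu hq u_odd q_even.
have Qv := derivative_mean hv hq v_odd q_even.
have iPu := sqintM sP hu; have iPv := sqintM sP hv.
have iQu := sqintM sQ hu; have iQv := sqintM sQ hv.
rewrite /Delta.
have -> : L2inner (opB L f) f = 0.
  rewrite /L2inner /cintegral; congr Complex.
    transitivity (\int[mu]_x (cpi^-1 * (P x * v x - Q x * u x))).
      apply: eq_Rintegral => x _; rewrite /opB /u /v /re_part /im_part -(ddE x).1 -(ddE x).2.
      by case: (f x) => a b; case: (ddir L f x) => a' b' /=; rewrite /cpi; ring.
    rewrite RintegralZl//; last exact: intbleB.
    by rewrite RintegralB// Pv Qu subr0 mulr0.
  transitivity (\int[mu]_x (cpi^-1 * (P x * u x + Q x * v x))).
    apply: eq_Rintegral => x _; rewrite /opB /u /v /re_part /im_part -(ddE x).1 -(ddE x).2.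
    by case: (f x) => a b; case: (ddir L f x) => a' b' /=; rewrite /cpi; ring.
  rewrite RintegralZl//; last exact: intbleD.
  by rewrite RintegralD// Pu Qv addr0 mulr0.
rewrite normc0 expr0n mul0r subr0 L2normE; last 2 first.
- by rewrite reE; exact: sqintZ.
- by rewrite imE; exact: sqintZ.
rewrite reE imE (scale _ _ sP) (scale _ _ sQ) sqrrN exprVn -mulrDr; congr (_ * _).
rewrite (derivative_orthogonal hp p_parity) (derivative_orthogonal hq q_parity).
by rewrite -big_split/=; apply: eq_bigr => i _; rewrite mulrDr addrC.
Qed.

(** The one-dimensional inequalities share the parameter t, so they can be added
    with weights L_i^2 before optimising; this replaces an application of the
    Cauchy-Schwarz inequality to the sums. *)
Lemma oscillator_ge t : 0 <= t -> 3 * t * (dotv L L * N) <= B + t ^+ 2 * A.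
Proof.
move=> t0.
rewrite /dotv mulr_suml mulr_sumr /A mulr_sumr /B -big_split/=; apply: ler_sum => i _.
have p_even : {ae mu, forall x, p i (flip_coord i x) = p i x}.
  by apply: filterS (p_parity i i) => x; rewrite eqxx.
have q_even : {ae mu, forall x, q i (flip_coord i x) = q i x}.
  by apply: filterS (q_parity i i) => x; rewrite eqxx.
have := odd_oscillator_ge t0 hu (hp i) (hxu i) (wp i) (u_odd i) p_even.
have := odd_oscillator_ge t0 hv (hq i) (hxv i) (wq i) (v_odd i) q_even.
rewrite -/(c i) -expr2 /N => h1 h2.
have := ler_wpM2l (sqr_ge0 (c i)) (lerD h1 h2).
by congr (_ <= _); ring.
Qed.

Lemma sqr_norm_gt0 : ~ {ae mu, forall x, f x = 0} -> 0 < N.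
Proof.
move=> f0; have N0 : 0 <= N.
  by apply: addr_ge0; apply: Rintegral_ge0 => x _; exact: sqr_ge0.
rewrite lt0r N0 andbT; apply/eqP => NE; apply: f0.
have iF : intble mu (fun x => u x ^+ 2 + v x ^+ 2) by apply: intbleD; [case: hu|case: hv].
have : (\int[mu]_x `|(u x ^+ 2 + v x ^+ 2)%:E| = 0)%E.
  under eq_integral => x _ do rewrite gee0_abs ?lee_fin ?addr_ge0 ?sqr_ge0//.
  rewrite -[LHS]fineK; last exact: integrable_fin_num iF.
  by congr EFin; rewrite -NE /N -RintegralD//; [case: hu|case: hv].
move/(ae_eq_integral_abs mu measurableT (measurable_int _ iF)).
apply: filterS => x /(_ I) [] /eqP.
rewrite paddr_eq0 ?sqr_ge0// !sqrf_eq0 /u /v /re_part /im_part.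
by case: (f x) => a b /= /andP[/eqP -> /eqP ->].
Qed.

Lemma UP_ge : L != 0 -> ~ {ae mu, forall x, f x = 0} -> 9 / 4 <= UP L f.
Proof.
move=> L0 /sqr_norm_gt0 N0.
have l0 := dotv_gt0 L0.
have A0 : 0 <= A.
  apply: sumr_ge0 => i _; rewrite mulr_ge0 ?sqr_ge0// addr_ge0//;
    by apply: Rintegral_ge0 => x _; exact: sqr_ge0.
have := quadratic_discriminant A0 (mulr_gt0 l0 N0) oscillator_ge.
rewrite /UP Delta_opA Delta_opB.
have -> : enorm L ^+ 4 = dotv L L ^+ 2 by rewrite -enorm_sqr -exprM.
have -> : L2norm f ^+ 4 = N ^+ 2 by rewrite (_ : N = L2norm f ^+ 2) -?exprM// (L2normE hu hv).
rewrite ler_pdivlMr ?mulr_gt0 ?exprn_gt0// exprMn => h.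
rewrite (_ : cpi ^+ 2 * A * (cpi ^- 2 * B) = A * B)//.
by field; rewrite gt_eqF.
Qed.

End uncertainty_odd.

Theorem lemma11 (R : realType) (d : nat) (L : 'rV[R]_d) (f : 'rV[R]_d -> R[i]) :
  L != 0 -> domA f -> domB f ->
  ~ {ae lebesgue_rV d, forall x, f x = 0} ->
  (forall k : 'I_d, {ae lebesgue_rV d, forall x, f x = - f (flip_coord k x)}) ->
  9 / 4 <= UP L f.
Proof. by move=> L0 fA fB f0 f_odd; exact: UP_ge. Qed.
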